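(* Let $T$ be an operator of the form $$Tf(x)=\mathrm{p.v.}\int_{\mathbb{R}^n}\frac{\Omega(x-y)}{|x-y|^n}f(y)\,dy ,$$ where $\Omega\in\mathrm{Lip}(S^{n-1})$ is homogeneous of degree zero, satisfies $\int_{S^{n-1}}\Omega=0$, and the set $\{\Omega(x)=0\}$ has zero measure. Let $b$ be a locally integrable function on $\mathbb{R}^n$ and suppose that $[b,T]:L^1(\mathbb{R}^n)\to L^{1,\infty}(\mathbb{R}^n)$ is bounded. Then $b\in L^\infty(\mathbb{R}^n)$ and $$\|b\|_{\infty}\le C(\Omega,n)\,\|[b,T]\|_{L^1\to L^{1,\infty}} ,$$ where $C(\Omega,n)$ is a constant depending only on $\Omega$ and $n$.
   Context: The commutator is defined, for smooth functions $f$, by $[b,T]f=T(bf)-bT(f)$. That $[b,T]:L^1(\mathbb{R}^n)\to L^{1,\infty}(\mathbb{R}^n)$ is bounded (that is, $[b,T]$ is of weak type $(1,1)$) means that there is $N<\infty$ with $t\,|\{x\in\mathbb{R}^n:|[b,T]f(x)|>t\}|\le N\|f\|_{L^1(\mathbb{R}^n)}$ for all $t>0$ and all $f$; the quantity $\|[b,T]\|_{L^1\to L^{1,\infty}}$ is the least such $N$. Here $|\cdot|$ of a set is Lebesgue measure, and $\|b\|_\infty$ is the $L^\infty(\mathbb{R}^n)$ norm.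
   Formalization: The inequality is proved for b modulo constants: some constant c has ‖b−c‖_∞ ≤ C(Ω,n)‖[b,T]‖, while b∈L^∞ is kept; the printed bound on ‖b‖_∞ fails for b=1, where [b,T]=0. *)

(* Defs.v *)
From HB Require Import structures.
From mathcomp Require Import all_boot all_order all_algebra.
From mathcomp Require Import all_classical all_reals all_analysis measurable_realfun.

Set Implicit Arguments.
Unset Strict Implicit.
Unset Printing Implicit Defensive.

Import Order.TTheory GRing.Theory Num.Theory.
Import numFieldNormedType.Exports.

Local Open Scope classical_set_scope.
Local Open Scope ring_scope.

(* Borel sigma-algebra of 'rV[R]_n, generated by the coordinates, as for
   n.-tuple in the library *)
Section measurable_rV.
Context {R : realType} (n : nat).

Definition rV_coord (i : 'I_n) (x : 'rV[R]_n) : R := x ord0 i.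

Let rV_set0 : g_sigma_preimage rV_coord set0.
Proof. exact: sigma_algebra0. Qed.

Let rV_setC A : g_sigma_preimage rV_coord A -> g_sigma_preimage rV_coord (~` A).
Proof. exact: sigma_algebraC. Qed.

Let rV_bigcup (F : _^nat) : (forall i, g_sigma_preimage rV_coord (F i)) ->
  g_sigma_preimage rV_coord (\bigcup_i (F i)).
Proof. exact: sigma_algebra_bigcup. Qed.

HB.instance Definition _ := @isMeasurable.Build default_measure_display
  'rV[R]_n (g_sigma_preimage rV_coord) rV_set0 rV_setC rV_bigcup.

Lemma measurable_rV_coord (i : 'I_n) : measurable_fun [set: 'rV[R]_n] (rV_coord i).
Proof.
move=> _ Y mY; rewrite setTI; apply: sub_sigma_algebra => /=.
rewrite -bigcup_seq/=; exists i => /=; first by rewrite mem_index_enum.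
by exists Y => //; rewrite setTI.
Qed.

Lemma measurable_fun_rV d (T : measurableType d) (f : T -> 'rV[R]_n) :
  (forall i, measurable_fun setT (rV_coord i \o f)) -> measurable_fun setT f.
Proof.
move=> mf; suff : g_sigma_preimage rV_coord `<=`
    image_set_system setT f (@measurable d T).
  by move=> sub _ A mA; exact: sub.
apply: smallest_sub.
  by apply: sigma_algebra_image; exact: sigma_algebra_measurable.
move=> A; rewrite -bigcup_seq => -[i _ [B mB <-]].
rewrite /image_set_system/= !setTI.
by have := mf i measurableT B mB; rewrite setTI.
Qed.

End measurable_rV.

Section lebesgue_rV.
Context {R : realType}.

Definition rV_cons n (p : measurableTypeR R * 'rV[R]_n) : 'rV[R]_n.+1 :=
  row_mx (p.1)%:M p.2 : 'rV[R]_(1 + n).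

Lemma measurable_rV_cons n : measurable_fun setT (@rV_cons n).
Proof.
apply: measurable_fun_rV => i.
case: (splitP (i : 'I_(1 + n))) => [j ij|j ij].
- rewrite (_ : _ \o _ = fst); first exact: measurable_fst.
  apply/funext => -[a v] /=; rewrite /rV_coord /rV_cons.
  have -> : i = lshift n j by apply/val_inj.
  by rewrite (@row_mxEl _ 1 1 n) mxE !ord1 mulr1n.
- rewrite (_ : _ \o _ = rV_coord j \o snd).
    apply: measurableT_comp; first exact: measurable_rV_coord.
    exact: measurable_snd.
  apply/funext => -[a v] /=; rewrite /rV_coord /rV_cons.
  have -> : i = rshift 1 j by apply/val_inj.
  by rewrite (@row_mxEr _ 1 1 n).
Qed.

Definition rV_uncons n (x : 'rV[R]_n.+1) : measurableTypeR R * 'rV[R]_n :=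
  (x ord0 ord0, rsubmx (x : 'rV[R]_(1 + n))).

Lemma measurable_rV_uncons n : measurable_fun setT (@rV_uncons n).
Proof.
apply/measurable_fun_pairP; split.
  exact: (@measurable_rV_coord R n.+1 ord0).
apply: measurable_fun_rV => i.
rewrite (_ : _ \o _ = rV_coord (rshift 1 i : 'I_n.+1)).
  exact: measurable_rV_coord.
by apply/funext => x; rewrite /rV_coord/= mxE.
Qed.

Lemma rV_consK n : cancel (@rV_cons n) (@rV_uncons n).
Proof.
move=> [a v]; rewrite /rV_uncons /rV_cons row_mxKr; congr pair.
rewrite (_ : ord0 = lshift n ord0 :> 'I_(1 + n)); last exact/val_inj.
by rewrite (@row_mxEl _ 1 1 n) mxE mulr1n.
Qed.

Lemma rV_uncons_K n : cancel (@rV_uncons n) (@rV_cons n).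
Proof.
move=> x; rewrite /rV_uncons /rV_cons/=.
suff -> : (x ord0 ord0)%:M = lsubmx (x : 'rV[R]_(1 + n)) by exact: (@hsubmxK _ 1 1 n x).
apply/rowP => i; rewrite !mxE (ord1 i) mulr1n.
by congr (x _ _); exact/val_inj.
Qed.

Section product_rV.
Variables (n : nat) (m : {sigma_finite_measure set 'rV[R]_n -> \bar R}).

Definition product_rV : set 'rV[R]_n.+1 -> \bar R :=
  pushforward (lebesgue_measure \x m)%E (@rV_cons n).

HB.instance Definition _ := Measure.copy product_rV
  (measure_function_pushforward__canonical__measure_function_Measure
     (lebesgue_measure \x m)%E (@measurable_rV_cons n)).

Let product_rV_sigma_finite : sigma_finite setT product_rV.
Proof.
have /sigma_finiteP[F [TF ndF Foo]] := sigma_finiteT (@lebesgue_measure R).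
have /sigma_finiteP[G [TG ndG Goo]] := sigma_finiteT m.
exists (fun k => @rV_uncons n @^-1` (F k `*` G k)).
  rewrite -preimage_bigcup -[LHS](preimage_setT (@rV_uncons n)); congr (_ @^-1` _).
  apply/seteqP; split => // -[x y] _.
  have : setT x by []. rewrite TF => -[i _ Fx].
  have : setT y by []. rewrite TG => -[j _ Gy].
  exists (maxn i j) => //; split.
  - by move: x Fx; exact/subsetPset/ndF/leq_maxl.
  - by move: y Gy; exact/subsetPset/ndG/leq_maxr.
move=> k; have [mF Fk] := Foo k; have [mG Gk] := Goo k.
have mFG : measurable (F k `*` G k) by exact: measurableX.
split.
  by rewrite -[_ @^-1` _]setTI; exact: measurable_rV_uncons.
rewrite /product_rV /pushforward -comp_preimage.
rewrite (_ : _ \o _ = id) ?preimage_id; last first.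
  by apply/funext => p /=; exact: rV_consK.
by rewrite product_measure1E// lte_mul_pinfty// ge0_fin_numE.
Qed.

HB.instance Definition _ := Measure_isSigmaFinite.Build _ _ _ product_rV
  product_rV_sigma_finite.

End product_rV.

Fixpoint lebesgue_rV n : {sigma_finite_measure set 'rV[R]_n -> \bar R} :=
  match n with
  | 0 => dirac (0 : 'rV[R]_0)
  | n'.+1 => product_rV (lebesgue_rV n')
  end.

End lebesgue_rV.

Section euclidean.
Context {R : realType} {n : nat}.
Implicit Types x y : 'rV[R]_n.

(* The norm `|x| of 'rV[R]_n in the library is the sup norm. *)
Definition enorm x : R := Num.sqrt (\sum_(i < n) x ord0 i ^+ 2).

Lemma measurable_enorm : measurable_fun setT enorm.
Proof.
rewrite (_ : enorm = @powR R ^~ 2^-1 \o (fun x => \sum_(i < n) x ord0 i ^+ 2)).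
  apply: measurableT_comp; first exact: measurable_powR.
  apply: measurable_sum => i; apply: measurable_funX.
  exact: (@measurable_rV_coord R n i).
by apply/funext => x /=; rewrite powR12_sqrt// sumr_ge0// => i _; exact: sqr_ge0.
Qed.

Definition usphere : set 'rV[R]_n := [set x | enorm x = 1].

Definition punctured_uball : set 'rV[R]_n := [set x | 0 < enorm x <= 1].

Lemma measurable_punctured_uball : measurable punctured_uball.
Proof.
rewrite (_ : punctured_uball = setT `&` enorm @^-1` `]0, 1]).
  by apply: measurable_enorm => //; exact: measurable_itv.
by apply/seteqP; split => x /=; rewrite in_itv/=; [split|case].
Qed.

Definition normalize x : 'rV[R]_n := (enorm x)^-1 *: x.

Lemma measurable_normalize : measurable_fun setT normalize.
Proof.
apply: measurable_fun_rV => i.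
rewrite (_ : _ \o _ = (@powR R ^~ (- 1) \o enorm) \* rV_coord i); last first.
  by apply/funext => x; rewrite /= powR_inv1 ?sqrtr_ge0// /rV_coord mxE.
apply: measurable_funM; last exact: measurable_rV_coord.
by apply: measurableT_comp; [exact: measurable_powR|exact: measurable_enorm].
Qed.

Definition cone_measure : set 'rV[R]_n -> \bar R :=
  pushforward (mrestr (lebesgue_rV n) measurable_punctured_uball) normalize.

HB.instance Definition _ := Measure.copy cone_measure
  (measure_function_pushforward__canonical__measure_function_Measure
    (mrestr (lebesgue_rV n) measurable_punctured_uball) measurable_normalize).

(* Surface measure of S^{n-1}, normalized as in polar coordinates:
   sigma(E) = n |{r theta : 0 < r <= 1, theta in E}| *)
Definition sphere_measure : set 'rV[R]_n -> \bar R :=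
  mscale (n%:R%:nng) cone_measure.

HB.instance Definition _ := Measure.on sphere_measure.

End euclidean.

Section commutator.
Context {R : realType} {n : nat}.
Implicit Types (f g b Omega : 'rV[R]_n -> R) (x y : 'rV[R]_n).
Local Notation mu := (lebesgue_rV n : {measure set 'rV[R]_n -> \bar R}).

Definition homogeneous0 Omega :=
  forall (r : R) x, 0 < r -> x != 0 -> Omega (r *: x) = Omega x.

Definition lipschitz_on_sphere Omega := exists L : R,
  forall x y, usphere x -> usphere y ->
    `|Omega x - Omega y| <= L * enorm (x - y).

Definition sing_kernel Omega x : R := Omega x / enorm x ^+ n.

Definition truncated_sio Omega (eps : R) f x : R :=
  (\int[mu]_(y in [set y | (eps < enorm (x - y))%R])
     (sing_kernel Omega (x - y) * f y))%R.

(* Principal value; lim is total and junk where the limit does not exist *)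
Definition sio Omega f x : R :=
  lim (truncated_sio Omega eps f x @[eps --> 0^'+]).

Definition commutator b Omega f x : R :=
  sio Omega (b \* f) x - b x * sio Omega f x.

Definition loc_integrable b := measurable_fun setT b /\
  forall K, compact K -> (\int[mu]_(x in K) `|b x|%:E < +oo)%E.

Definition iter_partial (s : seq 'I_n) f : 'rV[R]_n -> R :=
  foldr (fun i g x => 'D_(delta_mx ord0 i) g x) f s.

Definition smooth f := forall s x, differentiable (iter_partial s f) x.

Definition test_function f :=
  smooth f /\ exists M : R, forall x, M < enorm x -> f x = 0.

(* The outer measure mu^* agrees with Lebesgue measure on measurable sets,
   where alone lebesgue_rV is meaningful. *)
Definition weak_type11_bound b Omega (N : R) :=
  forall f, test_function f -> forall t : R, 0 < t ->
    (t%:E * mu_ext mu [set x | (t < `|commutator b Omega f x|)%R] <=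
     N%:E * 'N[mu]_1[EFin \o f])%E.

(* Operator norm of [b,T] from L^1 to L^{1,oo}; +oo if unbounded *)
Definition commutator_norm b Omega : \bar R :=
  ereal_inf [set N%:E | N in [set N | 0 <= N /\ weak_type11_bound b Omega N]].

(* Consequently [b,T] cannot bound the sup norm of b itself, but only its
   class modulo constants. *)
Lemma commutator_norm_cst1 Omega : commutator_norm (cst 1) Omega = 0%E.
Proof.
have weak0 : weak_type11_bound (cst 1) Omega 0.
  move=> f _ t t0; rewrite mul0e.
  rewrite (_ : [set x | _] = set0) ?mu_ext0 ?mule0//.
  apply/seteqP; split => // x /=.
  rewrite /commutator (_ : cst 1 \* f = f); last first.
    by apply/funext => y /=; rewrite mul1r.
  by rewrite /= mul1r subrr normr0 ltNge (ltW t0).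
apply/eqP; rewrite eq_le; apply/andP; split.
  by apply: ereal_inf_lbound; exists 0.
by apply: le_ereal_inf_tmp => _ [N [N0 _] <-]; rewrite lee_fin.
Qed.

End commutator.

(* Main.v *)
Require Import Defs.
From mathcomp Require Import all_boot all_order all_algebra.
From mathcomp Require Import all_classical all_reals all_analysis.
From mathcomp Require Import measurable_realfun ess_sup_inf.
From mathcomp Require Import ring lra.
Import Order.TTheory GRing.Theory Num.Theory.
Import numFieldNormedType.Exports.
Local Open Scope classical_set_scope.
Local Open Scope ring_scope.

Set Implicit Arguments.
Unset Strict Implicit.
Unset Printing Implicit Defensive.

(* At a point [x] away from the support of [f] no principal value is needed:
   [[b,T]f(x)] is the integral of [K(x - z) (b z - b x) f z]. Let [f]
   approximate, in [L^1((1 + |b|) dz)], the indicator of the set of points [z]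
   close to [y] at which [b z] is close to [b y]; for almost every [y] this set
   has positive measure. Then [|[b,T]f(x)|] is at least about
   [|K(x - y)| |b x - b y| |f|_1], and the weak type inequality bounds, for each
   lower bound of [|Omega(x - y)| |b x - b y|], the measure of the [x] at
   distance comparable to [r] from [y] at which it holds.
   Take now two such points [y1], [y2] at distance [r] and [D = |b y1 - b y2|].
   Every [x] satisfies [|b x - b y1| >= D / 2] or [|b x - b y2| >= D / 2], and
   since [Omega] is nonzero almost everywhere and homogeneous, most of the [x]
   in a cube of side [r] near [y1] and [y2] satisfy [|Omega(x - yi)| > delta]
   for [i = 1, 2], with [delta] depending on [Omega] and [n] only. Hence [r^n] is
   at most a multiple of [N r^n / D], that is, [D <= C N]. *)

(** * Row vectors and Lebesgue measure *)

Section cube.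
Context {R : realType} {n : nat}.
Implicit Types (x c : 'rV[R]_n) (r s t : R).

Lemma coord_le_norm x i : `|x ord0 i| <= `|x|.
Proof.
by rewrite [leRHS]mx_normrE (le_bigmax_cond _ (fun p => `|x p.1 p.2|) (j := (ord0, i))).
Qed.

Lemma norm_rV_lt x r : 0 < r -> (forall i, `|x ord0 i| < r) -> `|x| < r.
Proof.
move=> r0 xr; rewrite [ltLHS]mx_normrE bigmax_lt//= => -[i j] _ /=.
by rewrite (ord1 i).
Qed.

Lemma norm_rV_le x r : 0 <= r -> (forall i, `|x ord0 i| <= r) -> `|x| <= r.
Proof.
move=> r0 xr; rewrite [leLHS]mx_normrE bigmax_le//= => -[i j] _ /=.
by rewrite (ord1 i).
Qed.

Lemma measurable_rV_prod (J : 'I_n -> set R) : (forall i, measurable (J i)) ->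
  measurable [set x : 'rV[R]_n | forall i, J i (x ord0 i)].
Proof.
move=> mJ; rewrite (_ : [set _ | _] = \bigcap_(i in [set: 'I_n]) (rV_coord i @^-1` J i)).
  apply: fin_bigcap_measurable => [|i _]; first exact: finite_finset.
  by rewrite -[_ @^-1` _]setTI; apply: measurable_rV_coord.
by apply/seteqP; split => x /= h i; have := h i; exact.
Qed.

Definition box s t : set 'rV[R]_n := [set x | forall i, s < x ord0 i < t].

Lemma measurable_box s t : measurable (box s t).
Proof.
have -> : box s t = [set x | forall i, `]s, t[%classic (x ord0 i)].
  by apply/seteqP; split => x /= h i; have := h i; rewrite in_itv/=.
by apply: (measurable_rV_prod (J := fun=> `]s, t[%classic)) => i; exact: measurable_itv.
Qed.

Definition cube c r : set 'rV[R]_n := [set x | forall i, `|x ord0 i - c ord0 i| < r].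

Lemma cube_norm c r x : cube c r x -> 0 < r -> `|x - c| < r.
Proof. by move=> cx r0; apply: norm_rV_lt => // i; rewrite !mxE; exact: cx. Qed.

Lemma measurable_cube c r : measurable (cube c r).
Proof.
rewrite (_ : cube c r = [set x | forall i, `]c ord0 i - r, c ord0 i + r[%classic (x ord0 i)]).
  apply: (@measurable_rV_prod (fun i => `]c ord0 i - r, c ord0 i + r[%classic)) => i.
  exact: measurable_itv.
by apply/seteqP; split => x /= h i; have := h i; rewrite in_itv/= ltr_distl.
Qed.

(** A radius below [r / 2] suffices, by the triangle inequality through the rational centre. These
    cubes serve as a countable base, first for open sets and later for null preimages. *)
Lemma rational_cube x r : 0 < r -> exists p : 'rV[rat]_n * nat,
  let c : 'rV[R]_n := map_mx ratr p.1 in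
  cube c p.2.+1%:R^-1 x /\ cube c p.2.+1%:R^-1 `<=` cube x r.
Proof.
move=> r0; have [k kr] : exists k : nat, k.+1%:R^-1 < r / 2.
  have r20 : 0 < r / 2 by rewrite divr_gt0.
  exists (Num.truncn (r / 2)^-1).
  rewrite invf_plt ?posrE//. exact: truncnS_gt.
have : 0 < k.+1%:R^-1 :> R by [].
set e := k.+1%:R^-1 in kr *; move=> e0.
have h i : {q : rat | `|x ord0 i - ratr q| < e}.
  apply/cid; have [q] := @rat_in_itvoo R (x ord0 i - e) (x ord0 i + e)
    ltac:(by rewrite ltrD2l gt0_cp).
  rewrite in_itv/= => /andP[q1 q2]; exists q; rewrite ltr_norml; apply/andP; split; lra.
exists (\row_i sval (h i), k); rewrite /= -/e; split => [i|y yc i].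
  by rewrite !mxE; case: (h i).
have := yc i; rewrite !mxE; case: (h i) => q /= h1 h2.
rewrite -(subrKA (ratr q)) (le_lt_trans (ler_normD _ _))//.
rewrite distrC in h1; lra.
Qed.

(** The sigma-algebra is generated by the coordinates, so open sets have to be recovered: each is
    the countable union of the rational cubes that it contains. *)
Lemma open_measurable_rV (U : set 'rV[R]_n) : open U -> measurable U.
Proof.
move=> oU.
pose Q (p : 'rV[rat]_n * nat) : set 'rV[R]_n := cube (map_mx ratr p.1) p.2.+1%:R^-1.
rewrite (_ : U = \bigcup_p (if pselect (Q p `<=` U) then Q p else set0)).
  apply: countable_bigcupT_measurable => [|p]; first exact: countableP.
  by case: (pselect (Q p `<=` U)) => ? /=; [exact: measurable_cube|exact: measurable0].
apply/seteqP; split => [x Ux|x [p _]]; last by case: (pselect (Q p `<=` U)) => // pU; exact: pU.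
have /nbhs_ballP[e /= e0 eU] : nbhs x U by exact: open_nbhs_nbhs.
have [p [px pe]] := rational_cube x e0.
exists p => //=; case: (pselect (Q p `<=` U)) => // -[] y /pe ye.
apply: eU; rewrite -ball_normE /= distrC.
exact: cube_norm.
Qed.

Lemma continuous_measurable_rV (f : 'rV[R]_n -> R) :
  continuous f -> measurable_fun setT f.
Proof.
move=> /continuousP cf; apply: (measurability _ (RGenOInfty.measurableE R)).
move=> _ [_ [a ->] <-]; rewrite setTI; apply: open_measurable_rV; exact: cf.
Qed.

End cube.

(** * Lebesgue measure under dilations and translations *)

Section affine.
Context {R : realType}.

Lemma measurable_rV_affine n (a : R) (v : 'rV[R]_n) :
  measurable_fun setT (fun x : 'rV[R]_n => a *: x + v).
Proof.
apply: measurable_fun_rV => i.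
rewrite (_ : _ \o _ = (fun x => a * rV_coord i x + v ord0 i)); last first.
  by apply/funext => x; rewrite /= /rV_coord !mxE.
apply: measurable_funD; last exact: measurable_cst.
by apply: measurable_funM; [exact: measurable_cst|exact: measurable_rV_coord].
Qed.

Lemma measurable_affine (a v : R) :
  measurable_fun setT (fun z : measurableTypeR R => (a * z + v : measurableTypeR R)).
Proof.
apply: measurable_funD; last exact: measurable_cst.
by apply: measurable_funM; [exact: measurable_cst|exact: measurable_id].
Qed.

(** The left side is a measure in [A] that agrees with Lebesgue measure on half-open intervals. *)
Lemma lebesgue_measure_affine (r v : R) (A : set (measurableTypeR R)) : 0 < r ->
  measurable A ->
  (r%:E * lebesgue_measure ((fun z : measurableTypeR R => r * z + v)%R @^-1` A) =
  lebesgue_measure A)%E.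
Proof.
move=> r0 mA.
pose m := mscale (NngNum (ltW r0))
  (measure_function_pushforward__canonical__measure_function_Measure
     (@lebesgue_measure R) (measurable_affine r v)).
have mE B : m B =
  (r%:E * lebesgue_measure ((fun z : measurableTypeR R => r * z + v)%R @^-1` B))%E by [].
rewrite -mE; apply/esym; apply: lebesgue_measure_unique mA => _ [[a b]] _ <-.
  rewrite [RHS]mE /=.
  rewrite (_ : _ @^-1` _ = `](a - v) / r, (b - v) / r]%classic); last first.
    apply/seteqP; split => z /=;
      by rewrite !in_itv/= ltr_pdivrMr// ler_pdivlMr// ltrBlDr lerBrDr mulrC.
  rewrite !lebesgue_measure_itv/= !lte_fin ltr_pM2r ?invr_gt0// ltrD2r.
  case: ifP => // _; last by rewrite mule0.
  rewrite -EFinB -EFinB -EFinM; congr EFin. field; exact: lt0r_neq0.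
Qed.

(** Induction on the dimension: in [n.+1] coordinates the measure is the image of a product, and a
    product measure is determined on rectangles, where the one-dimensional case and the induction
    hypothesis handle the two factors. *)
Lemma lebesgue_rV_affine n (r : R) (v : 'rV[R]_n) (A : set 'rV[R]_n) : 0 < r ->
  measurable A ->
  ((r ^+ n)%:E * lebesgue_rV n ((fun x => r *: x + v)%R @^-1` A) = lebesgue_rV n A)%E.
Proof.
move=> r0; elim: n v A => [|n IH] v A mA.
  by rewrite expr0 mul1e; congr (lebesgue_rV _ _); apply/seteqP; split => x /=;
    rewrite (thinmx0 (_ + _)) (thinmx0 x).
pose v' : 'rV[R]_n := rsubmx (v : 'rV[R]_(1 + n)).
pose psi (p : measurableTypeR R * 'rV[R]_n) : measurableTypeR R * 'rV[R]_n :=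
   (r * p.1 + v ord0 ord0, r *: p.2 + v').
have mpsi : measurable_fun setT psi.
  apply/measurable_fun_pairP; split.
    exact: (measurableT_comp (@measurable_affine r (v ord0 ord0)) measurable_fst).
  exact: (measurableT_comp (@measurable_rV_affine _ r v') measurable_snd).
pose m := mscale (NngNum (ltW (exprn_gt0 n.+1 r0)))
  (measure_function_pushforward__canonical__measure_function_Measure
     (lebesgue_measure \x lebesgue_rV n)%E mpsi).
have mB : measurable (@rV_cons R n @^-1` A).
  by rewrite -[_ @^-1` _]setTI; exact: measurable_rV_cons.
have mE B : m B = ((r ^+ n.+1)%:E * (lebesgue_measure \x lebesgue_rV n) (psi @^-1` B))%E by [].
have : (lebesgue_measure \x lebesgue_rV n)%E (@rV_cons R n @^-1` A) = m (@rV_cons R n @^-1` A).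
  apply: product_measure_unique mB => A1 A2 mA1 mA2.
  rewrite [LHS]mE (_ : psi @^-1` _ = 
    ((fun z => r * z + v ord0 ord0) @^-1` A1) `*` ((fun x => r *: x + v') @^-1` A2))//.
  rewrite product_measure1E; last 2 first.
  - by rewrite -[_ @^-1` _]setTI; exact: measurable_affine.
  - by rewrite -[_ @^-1` _]setTI; exact: measurable_rV_affine.
  rewrite exprS EFinM muleACA lebesgue_measure_affine// IH//.
rewrite mE => E; rewrite [RHS]E; congr (_ * _)%E; congr ((lebesgue_measure \x lebesgue_rV n)%E _).
have E' p : r *: rV_cons p + v = rV_cons (psi p).
  case: p => z x; apply: (can_inj (@rV_uncons_K R n)); rewrite rV_consK.
  have [e1 e2] := rV_consK (z, x); rewrite /rV_uncons /psi/=; congr pair.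
    by rewrite -[in RHS]e1 !mxE.
  by rewrite linearD/= linearZ/= e2.
by apply/seteqP; split => p /=; rewrite E'.
Qed.

Lemma lebesgue_rV_unit_box n (a : R) :
  lebesgue_rV n (box a (a + 1) : set 'rV[R]_n) = 1%E.
Proof.
elim: n => [|n IH].
  by rewrite /= /dirac/= indicE mem_set// => -[].
transitivity ((lebesgue_measure \x lebesgue_rV n)%E
    (`]a, a + 1[%classic `*` (box a (a + 1) : set 'rV[R]_n))).
  congr ((lebesgue_measure \x lebesgue_rV n)%E _).
  apply/seteqP; split => -[z x]; rewrite /= in_itv/=;
    have [e1 e2] := rV_consK (z, x);
    have e2i i : rV_cons (z, x) ord0 (rshift 1 i) = x ord0 i by rewrite -[in RHS]e2 [RHS]mxE.
  - move=> h; split => [|i]; first by have := h ord0; rewrite e1.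
    by have := h (rshift 1 i); rewrite e2i.
  - move=> [hz hx] i; case: (splitP (i : 'I_(1 + n))) => [j ij|j ij].
      by rewrite (_ : i = ord0) ?e1//; apply/val_inj; rewrite /= ij (ord1 j).
    by rewrite (_ : i = rshift 1 j) ?e2i//; exact/val_inj.
have mU : measurable (box a (a + 1) : set 'rV[R]_n) by exact: measurable_box.
rewrite product_measure1E//.
rewrite IH mule1 [LHS]lebesgue_measure_itv/= lte_fin ltrDl ltr01.
by rewrite -EFinB addrC addKr.
Qed.

End affine.

(** * The Euclidean norm and homogeneous functions *)

Section enorm.
Context {R : realType} {n : nat}.
Implicit Types (x u v : 'rV[R]_n).

Lemma enorm_ge0 x : 0 <= enorm x.
Proof. exact: sqrtr_ge0. Qed.

Lemma sqr_enorm x : enorm x ^+ 2 = \sum_(i < n) x ord0 i ^+ 2.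
Proof. by rewrite sqr_sqrtr// sumr_ge0// => i _; exact: sqr_ge0. Qed.

Lemma coord_le_enorm x i : `|x ord0 i| <= enorm x.
Proof.
rewrite -(@ler_pXn2r _ 2)// ?nnegrE ?enorm_ge0// sqr_enorm real_normK ?num_real//.
by rewrite (bigD1 i)//= lerDl sumr_ge0// => j _; exact: sqr_ge0.
Qed.

Lemma norm_le_enorm x : `|x| <= enorm x.
Proof. by apply: norm_rV_le; [exact: enorm_ge0|exact: coord_le_enorm]. Qed.

Lemma enorm_le_norm x : enorm x <= n%:R * `|x|.
Proof.
rewrite -(@ler_pXn2r _ 2)// ?nnegrE ?enorm_ge0 ?mulr_ge0// sqr_enorm.
apply: (@le_trans _ _ (\sum_(i < n) `|x| ^+ 2)).
  apply: ler_sum => i _; rewrite -real_normK ?num_real//.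
  by rewrite ler_pXn2r ?nnegrE// coord_le_norm.
rewrite sumr_const card_ord exprMn -[leLHS]mulr_natl ler_wpM2r ?sqr_ge0//.
by rewrite -natrX ler_nat; case: (n) => // k; rewrite leq_pmulr.
Qed.

Lemma enorm_gt0 x : (0 < enorm x) = (x != 0).
Proof.
apply/idP/idP => [|x0]; last by rewrite (lt_le_trans _ (norm_le_enorm x))// normr_gt0.
by apply: contraTneq => ->; rewrite -leNgt (le_trans (enorm_le_norm _))// normr0 mulr0.
Qed.

Lemma enormZ (a : R) x : enorm (a *: x) = `|a| * enorm x.
Proof.
apply/eqP; rewrite -(@eqrXn2 _ 2)// ?mulr_ge0 ?enorm_ge0//.
rewrite exprMn !sqr_enorm real_normK ?num_real// mulr_sumr; apply/eqP/eq_bigr => i _.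
by rewrite mxE exprMn.
Qed.

(* The difference of squares [u_i ^ 2 - v_i ^ 2] factors, and the factors
   [u_i + v_i] are at most [enorm u + enorm v]. *)
Lemma ler_dist_enorm u v : `|enorm u - enorm v| <= n%:R * `|u - v|.
Proof.
have [->|u0] := eqVneq u 0.
  have -> : enorm (0 : 'rV[R]_n) = 0.
    by apply/eqP; rewrite eq_le enorm_ge0 leNgt enorm_gt0 eqxx.
  by rewrite !sub0r !normrN (ger0_norm (enorm_ge0 v)) enorm_le_norm.
have s0 : 0 < enorm u + enorm v by rewrite ltr_wpDr ?enorm_ge0// enorm_gt0.
rewrite -(ler_pM2r s0) -{1}(gtr0_norm s0) -normrM -subr_sqr !sqr_enorm -sumrB.
rewrite (le_trans (ler_norm_sum _ _ _))//.
rewrite (le_trans (ler_sum _ (fun i _ => _ : _ <= `|u - v| * (enorm u + enorm v))))//.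
  move=> i _; rewrite subr_sqr normrM ler_pM//.
    by have := coord_le_norm (u - v) i; rewrite !mxE.
  by rewrite (le_trans (ler_normD _ _))// lerD// coord_le_enorm.
by rewrite sumr_const card_ord -[leLHS]mulr_natl mulrA.
Qed.

Lemma usphere_normalize u : u != 0 -> usphere (normalize u).
Proof.
move=> u0; rewrite /usphere/= /normalize enormZ.
by rewrite ger0_norm ?invr_ge0 ?enorm_ge0// mulVf// gt_eqF// enorm_gt0.
Qed.

Lemma ler_dist_normalize u v : u != 0 -> v != 0 ->
  `|normalize u - normalize v| <= (1 + n%:R) * `|u - v| / `|u|.
Proof.
move=> u0 v0.
have eu : 0 < enorm u by rewrite enorm_gt0.
have ev : 0 < enorm v by rewrite enorm_gt0.
(* Since [|v| <= enorm v], the coefficient of [v] compensates its length: only [u] stays in the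
   denominator, and [v] may be arbitrarily small. *)
have -> : normalize u - normalize v =
    (enorm u)^-1 *: ((u - v) + ((enorm v - enorm u) / enorm v) *: v).
  rewrite /normalize; apply/rowP => i; rewrite !mxE; field.
  by rewrite !gt_eqF.
rewrite normrZ gtr0_norm ?invr_gt0// mulrC ler_pM ?invr_ge0 ?enorm_ge0//; last first.
  by rewrite lef_pV2 ?posrE ?normr_gt0// norm_le_enorm.
rewrite (le_trans (ler_normD _ _))// [leRHS]mulrDl mul1r lerD2l normrZ normrM.
rewrite normfV (gtr0_norm ev) -mulrA distrC.
rewrite (le_trans _ (ler_dist_enorm u v))// ler_piMr// ler_pdivrMl// mulr1.
exact: norm_le_enorm.
Qed.

End enorm.

Section homogeneous_lipschitz.
Context {R : realType} {n : nat}.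
Variable Omega : 'rV[R]_n -> R.
Hypothesis Omega_hom : homogeneous0 Omega.
Hypothesis Omega_lip : lipschitz_on_sphere Omega.

Lemma homogeneous0_normalize u : u != 0 -> Omega (normalize u) = Omega u.
Proof. by move=> u0; rewrite Omega_hom// invr_gt0 enorm_gt0. Qed.

Lemma homogeneous0_lipschitz : exists2 L : R, 0 < L &
  forall u v, u != 0 -> v != 0 ->
    `|Omega u - Omega v| <= L * `|normalize u - normalize v|.
Proof.
have [L lipL] := Omega_lip; exists ((`|L| + 1) * (n%:R + 1)).
  by rewrite mulr_gt0 ?ltr_wpDl.
move=> u v u0 v0; rewrite -(homogeneous0_normalize u0) -(homogeneous0_normalize v0).
rewrite (le_trans (lipL _ _ (usphere_normalize u0) (usphere_normalize v0)))//.
rewrite -mulrA (le_trans (ler_wpM2r (enorm_ge0 _) (ler_norm L)))// ler_pM ?enorm_ge0//.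
  by rewrite lerDl.
by rewrite (le_trans (enorm_le_norm _))// ler_wpM2r// lerDl.
Qed.

Lemma homogeneous0_dist : exists2 L : R, 0 < L &
  forall u v, u != 0 -> v != 0 -> `|Omega u - Omega v| <= L * `|u - v| / `|u|.
Proof.
have [L L0 lipL] := homogeneous0_lipschitz; exists (L * (1 + n%:R)).
  by rewrite mulr_gt0 ?ltr_wpDr.
move=> u v u0 v0; rewrite (le_trans (lipL _ _ u0 v0))//.
by rewrite -!mulrA ler_pM2l// mulrA ler_dist_normalize.
Qed.

(** Comparison with one fixed nonzero vector: normalized vectors have norm at most 1, so two of them
    differ by at most 2. *)
Lemma homogeneous0_bounded : (0 < n)%N ->
  exists2 B : R, 0 < B & forall u, u != 0 -> `|Omega u| <= B.
Proof.
move=> n0; have [L L0 lipL] := homogeneous0_lipschitz.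
pose e : 'rV[R]_n := const_mx 1.
have e0 : e != 0.
  by apply/eqP => /rowP/(_ (Ordinal n0)); rewrite !mxE => /eqP; rewrite oner_eq0.
exists (L * 2 + `|Omega e|); first by rewrite ltr_wpDr// mulr_gt0.
move=> u u0; rewrite -(subrK (Omega e) (Omega u)) (le_trans (ler_normD _ _))// lerD2r.
rewrite (le_trans (lipL _ _ u0 e0))// ler_pM2l// (le_trans (ler_normB _ _))//.
have h v : v != 0 -> `|normalize v| <= 1.
  by move=> v0; rewrite -(usphere_normalize v0) norm_le_enorm.
by rewrite (_ : 2 = 1 + 1)// lerD// h.
Qed.

(** [Omega] is continuous off the origin, while its value at the origin is arbitrary; a superlevel
    set is therefore an open set with the origin possibly added. *)
Lemma measurable_homogeneous0 : measurable_fun setT Omega.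
Proof.
have [L L0 lipL] := homogeneous0_dist.
apply: (measurability _ (RGenOInfty.measurableE R)).
move=> _ [_ [a ->] <-]; rewrite setTI.
rewrite (_ : _ @^-1` _ = [set x | x != 0 /\ a < Omega x] `|` 
   ([set x | forall i, [set 0] (x ord0 i)] `&` [set x | a < Omega 0])); last first.
  apply/seteqP; split => x /=; rewrite in_itv/= andbT.
    move=> ax; have [x0|x0] := eqVneq x 0; last by left.
    by right; split => [i|]; rewrite -?x0// x0 mxE.
  move=> [[]//|[x0]]; rewrite (_ : x = 0)//; apply/rowP => i; rewrite x0 mxE//.
apply: measurableU.
  apply: open_measurable_rV; rewrite openE => x [x0 ax].
  have nx : 0 < `|x| by rewrite normr_gt0.
  (* The first radius keeps [y] off the origin, the second makes the variation of [Omega] smaller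
     than [Omega x - a]. *)
  apply/nbhs_ballP; exists (Num.min `|x| ((Omega x - a) * `|x| / L)) => /=.
    by rewrite lt_min nx/= divr_gt0// mulr_gt0// subr_gt0.
  move=> y; rewrite -ball_normE/= lt_min => /andP[y1 y2].
  have y0 : y != 0 by apply: contraTneq y1 => ->; rewrite subr0 ltxx.
  split => //; have := lipL _ _ x0 y0.
  move: y2; rewrite ltr_pdivlMr// mulrC -ltr_pdivrMr// => y2 /le_lt_trans/(_ y2).
  rewrite ltr_distl => /andP[_]; lra.
apply: measurableI.
  by apply: (measurable_rV_prod (J := fun=> [set 0])) => i; exact: measurable_set1.
have mP (P : Prop) : measurable ((fun=> P) : set 'rV[R]_n).
  have [/propT ->|/propF ->] := pselect P.
    exact: measurableT.
  exact: measurable0.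
exact: mP.
Qed.

End homogeneous_lipschitz.

(** * Smooth functions with compact support *)

Section flat.
Context {R : realType}.
Implicit Types (m : nat) (z h : R).

(** These are the functions [z^(-m) exp(-1/z)] extended by zero. All exponents [m] are kept because
    differentiation raises them, as [is_derive_flat] shows. *)
Definition flat m z : R := if 0 < z then z^-1 ^+ m * expR (- z^-1) else 0.

Lemma flat_gt0 m z : 0 < z -> flat m z = z^-1 ^+ m * expR (- z^-1).
Proof. by rewrite /flat => ->. Qed.

Lemma flat_le0 m z : z <= 0 -> flat m z = 0.
Proof. by rewrite /flat leNgt => /negbTE ->. Qed.

(** The term of order [m + 2] of the exponential series at [1 / z] absorbs [z^(-m)] and leaves
    [z ^ 2]. This order of vanishing yields differentiability at the origin. *)
Lemma flat_sqr m z : `|flat m z| <= (m.+2)`!%:R * z ^+ 2.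
Proof.
have [z0|z0] := leP z 0.
  by rewrite flat_le0// normr0 mulr_ge0// sqr_ge0.
rewrite flat_gt0// ger0_norm ?mulr_ge0 ?exprn_ge0 ?expR_ge0 ?invr_ge0 ?(ltW z0)//.
rewrite expRN ler_pdivrMr ?expR_gt0//.
have w0 : 0 <= z^-1 by rewrite invr_ge0 ltW.
have f0 : 0 < (m.+2)`!%:R :> R by rewrite ltr0n fact_gt0.
have e : z^-1 ^+ m.+2 <= expR z^-1 * (m.+2)`!%:R.
  by rewrite -ler_pdivrMr// (le_trans _ (expR_ge1Dxn m.+1 w0))// lerDr.
have -> : z^-1 ^+ m = z^-1 ^+ m.+2 * z ^+ 2.
  by rewrite -addn2 exprD -mulrA -exprMn mulVf ?expr1n ?mulr1 ?gt_eqF.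
by rewrite [leRHS]mulrAC [X in _ <= X * _]mulrC ler_wpM2r// sqr_ge0.
Qed.

Lemma is_derive_flat m z : is_derive z 1 (flat m) (flat m.+2 z - m%:R * flat m.+1 z).
Proof.
have [z0|z0|<-] := ltgtP 0 z.
- have zV : z != 0 by rewrite gt_eqF.
  have dV : is_derive z 1 (fun y : R => y^-1) (- z ^- 2).
    by have := @is_deriveV _ id z 1 1 zV _; rewrite scaler1; apply.
  apply: (@near_eq_is_derive _ _ _
      (((fun y : R => y^-1) ^+ m) * (expR \o (- (fun y : R => y^-1))))).
    near=> y; rewrite flat_gt0//=.
      by rewrite !fctE.
    by near: y; exact: lt_nbhsr.
  apply: is_derive_eq.
  rewrite !flat_gt0// !fctE /=; case: m => [|m] /=.
    by rewrite /GRing.scale/= -!exprVn; ring.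
  by rewrite /GRing.scale/= -!exprVn !exprS; ring.
- have zm k : flat k z = 0 by rewrite flat_le0// ltW.
  rewrite !zm mulr0 subr0; apply: (@near_eq_is_derive _ _ _ (cst 0)).
  near=> y; rewrite flat_le0// ltW//; near: y; exact: lt_nbhsl.
- have zm k : flat k 0 = 0 by rewrite flat_le0.
  rewrite !zm mulr0 subr0.
  (* By [flat_sqr] the difference quotient at the origin is at most a constant times [|h|]. *)
  suff h0 : (fun h => h^-1 *: ((flat m \o shift 0) (h *: 1) - flat m 0)) @ 0^' --> 0.
    by apply: DeriveDef; [apply/cvg_ex; exists 0|exact: cvg_lim].
  apply/cvgr0Pnorm_le => e e0; near=> h.
  have f0 : 0 < (m.+2)`!%:R :> R by rewrite ltr0n fact_gt0.
  have h0 : 0 < `|h| by rewrite normr_gt0; near: h; exact: nbhs_dnbhs_neq.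
  rewrite /= addr0 zm subr0 normrM normfV /GRing.scale/= mulr1 ler_pdivrMl//.
  rewrite (le_trans (flat_sqr _ _))// -real_normK ?num_real// expr2 mulrCA ler_pM2l//.
  rewrite -ler_pdivlMl// mulrC; near: h; apply: dnbhs0_le; exact: divr_gt0.
Unshelve. all: by end_near. Qed.
End flat.

Section flat_algebra.
Context {R : realType} {n : nat}.
Implicit Types (f g : 'rV[R]_n -> R) (x v : 'rV[R]_n) (i : 'I_n).

(** The class is closed under directional derivatives, so smoothness of its members reduces to their
    differentiability. It contains the bump functions used below. *)
Inductive flat_algebra : ('rV[R]_n -> R) -> Prop :=
| flat_algebra_cst c : flat_algebra (cst c)
| flat_algebra_flat m a i c : flat_algebra (fun x => flat m (a * x ord0 i + c))
| flat_algebraD f g : flat_algebra f -> flat_algebra g -> flat_algebra (f + g)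
| flat_algebraM f g : flat_algebra f -> flat_algebra g -> flat_algebra (f * g).

Lemma flat_algebraN f : flat_algebra f -> flat_algebra (- f).
Proof.
move=> af; rewrite (_ : - f = cst (-1) * f).
  by apply: flat_algebraM => //; exact: flat_algebra_cst.
by apply/funext => x; rewrite !fctE mulN1r.
Qed.

Lemma flat_algebra_prod (I : Type) (s : seq I) (F : I -> 'rV[R]_n -> R) :
  (forall j, flat_algebra (F j)) -> flat_algebra (fun x => \prod_(j <- s) F j x).
Proof.
move=> aF; elim: s => [|i s IH].
  rewrite (_ : (fun _ => _) = cst 1); first exact: flat_algebra_cst.
  by apply/funext => x; rewrite big_nil.
rewrite (_ : (fun _ => _) = F i * (fun x => \prod_(j <- s) F j x)).
  exact: flat_algebraM.
by apply/funext => x; rewrite big_cons.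
Qed.

Lemma differentiable_affine_coord (a c : R) i x :
  differentiable (fun y : 'rV[R]_n => a * y ord0 i + c) x.
Proof.
apply: differentiableD; last exact: differentiable_cst.
by apply: differentiableM; [exact: differentiable_cst|exact: differentiable_coord].
Qed.

Lemma differentiable_flat m z : differentiable (@flat R m) z.
Proof. by apply/derivable1_diffP; case: (is_derive_flat m z). Qed.

Lemma differentiable_flat_algebra f : flat_algebra f -> forall x, differentiable f x.
Proof.
elim=> [c|m a i c|{}f g _ df _ dg|{}f g _ df _ dg] x.
- exact: differentiable_cst.
- apply: (@differentiable_comp _ _ _ _ (fun y : 'rV[R]_n => a * y ord0 i + c) (flat m)).
    exact: differentiable_affine_coord.
  exact: differentiable_flat.
- exact: differentiableD.
- exact: differentiableM.
Qed.

Lemma derive_flat_coord m (a c : R) i x v :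
  'D_v (fun y : 'rV[R]_n => flat m (a * y ord0 i + c)) x =
  a * v ord0 i * (flat m.+2 (a * x ord0 i + c) - m%:R * flat m.+1 (a * x ord0 i + c)).
Proof.
(* Along [v] the argument of [flat m] moves with speed [a * v ord0 i], so the two difference
   quotients coincide. *)
transitivity ('D_(a * v ord0 i) (@flat R m) (a * x ord0 i + c)).
  rewrite /derive; congr (lim (_ @ 0^')); apply/funext => h /=.
  by congr (_ *: (flat m _ - _)); rewrite !mxE /GRing.scale/=; ring.
have df := differentiable_flat m (a * x ord0 i + c).
by rewrite deriveE// diff1E// derive1E (@derive_val _ _ _ _ _ _ _ (is_derive_flat m _)).
Qed.

Lemma flat_algebra_derive f v : flat_algebra f -> flat_algebra ('D_v f).
Proof.
elim=> [c|m a i c|{}f g af df ag dg|{}f g af df ag dg].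
- rewrite (_ : 'D_v _ = cst 0); first exact: flat_algebra_cst.
  by apply/funext => x; rewrite derive_cst.
- rewrite (_ : 'D_v _ = cst (a * v ord0 i) * ((fun y => flat m.+2 (a * y ord0 i + c)) -
     cst m%:R * (fun y => flat m.+1 (a * y ord0 i + c)))).
    apply: flat_algebraM; first exact: flat_algebra_cst.
    apply: flat_algebraD; first exact: flat_algebra_flat.
    apply: flat_algebraN; apply: flat_algebraM; first exact: flat_algebra_cst.
    exact: flat_algebra_flat.
  by apply/funext => x; rewrite derive_flat_coord.
- rewrite (_ : 'D_v _ = 'D_v f + 'D_v g); first exact: flat_algebraD.
  by apply/funext => x; rewrite deriveD//; apply/diff_derivable/differentiable_flat_algebra.
- rewrite (_ : 'D_v _ = f * 'D_v g + g * 'D_v f).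
    by apply: flat_algebraD; exact: flat_algebraM.
  by apply/funext => x; rewrite deriveM//; apply/diff_derivable/differentiable_flat_algebra.
Qed.

Lemma smooth_flat_algebra f : flat_algebra f -> smooth f.
Proof.
move=> af s; apply: differentiable_flat_algebra.
by elim: s => //= i s; exact: flat_algebra_derive.
Qed.

Lemma continuous_flat_algebra f : flat_algebra f -> continuous f.
Proof. by move=> af x; exact/differentiable_continuous/differentiable_flat_algebra. Qed.

Lemma measurable_flat_algebra f : flat_algebra f -> measurable_fun setT f.
Proof. by move=> /continuous_flat_algebra; exact: continuous_measurable_rV. Qed.

End flat_algebra.

Section flat_limit.
Context {R : realType}.

Lemma flat0_itv01 (z : R) : 0 <= flat 0 z <= 1.
Proof.
rewrite /flat; case: ifP => [z0|_]; last by rewrite lexx ler01.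
by rewrite expr0 mul1r expR_ge0/= expR_le1 oppr_le0 invr_ge0 ltW.
Qed.

(** The value is [exp(-1 / (k.+1 * z))]. The dilates of [flat 0] thus tend to the indicator of the
    positive half-line. *)
Lemma cvg_flat0 (z : R) : 0 < z -> flat 0 (k.+1%:R * z) @[k --> \oo] --> (1 : R).
Proof.
move=> z0.
rewrite (_ : (fun _ => _) = (fun k => expR (- (z^-1 * harmonic k)))); last first.
  apply/funext => k; rewrite flat_gt0 ?mulr_gt0// expr0 mul1r invfM.
  by rewrite /harmonic/= mulrC.
rewrite -[X in _ --> X]expR0; apply: continuous_cvg; first exact: continuous_expR.
rewrite -oppr0; apply: cvgN; rewrite -(mulr0 z^-1); apply: cvgMr.
exact: cvg_harmonic.
Qed.

End flat_limit.

(** * Density of smooth functions *)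

Section halfspaces.
Context {R : realType} {n : nat}.
Local Notation halfspace := ('I_n * R * R)%type.
Implicit Types (s : seq halfspace) (x : 'rV[R]_n).

(* [(i, a, c)] encodes the half-space [0 < a * x_i + c]. *)
Definition halfspace_fun (p : halfspace) x : R := p.1.2 * x ord0 p.1.1 + p.2.

Definition halfspaces s : set 'rV[R]_n := [set x | all (fun p => 0 < halfspace_fun p x) s].

Lemma halfspaces_cat s1 s2 : halfspaces (s1 ++ s2) = halfspaces s1 `&` halfspaces s2.
Proof.
by apply/seteqP; split => x; rewrite /halfspaces/= all_cat => /andP.
Qed.

Lemma measurable_halfspaces s : measurable (halfspaces s).
Proof.
elim: s => [|p s IH].
  by rewrite (_ : halfspaces _ = setT)//; apply/seteqP; split.
rewrite -cat1s halfspaces_cat; apply: measurableI => //.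
rewrite (_ : halfspaces _ = setT `&` halfspace_fun p @^-1` `]0, +oo[).
  apply: (_ : measurable_fun setT (halfspace_fun p)) => //.
  apply: measurable_funD; last exact: measurable_cst.
  by apply: measurable_funM; [exact: measurable_cst|exact: (@measurable_rV_coord R n p.1.1)].
by apply/seteqP; split => x /=; rewrite /halfspaces/= in_itv/= !andbT; [|case].
Qed.

(** The half-spaces [a < x_i] already generate the coordinate sigma-algebra. Finite intersections
    are used so that the generating family is stable under intersection. *)
Lemma measurable_halfspacesE (A : set 'rV[R]_n) : measurable A -> <<s range halfspaces >> A.
Proof.
apply: smallest_sub; first exact: smallest_sigma_algebra.
move=> B; rewrite -bigcup_seq => -[i _ [C mC <-]]; rewrite setTI.
suff : (@measurable _ (measurableTypeR R)) `<=`
    image_set_system setT (rV_coord i) <<s range halfspaces >>.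
  by move=> /(_ _ mC); rewrite /image_set_system/= setTI.
rewrite [X in X `<=` _](RGenOInfty.measurableE R); apply: smallest_sub.
  by apply: sigma_algebra_image; exact: smallest_sigma_algebra.
move=> _ [a ->]; rewrite /image_set_system/= setTI; apply: sub_sigma_algebra.
exists [:: (i, 1, - a)] => //; apply/seteqP; split => x;
  by rewrite /halfspaces/= /halfspace_fun/= /rV_coord in_itv/= !andbT mul1r subr_gt0.
Qed.

Lemma cubeE (c : 'rV[R]_n) (r : R) : exists s, cube c r = halfspaces s.
Proof.
exists ([seq (i, 1, r - c ord0 i) | i <- enum 'I_n] ++
  [seq (i, -1, r + c ord0 i) | i <- enum 'I_n]).
rewrite halfspaces_cat; apply/seteqP; split => x /=.
  move=> cx; split; apply/allP => _ /mapP[i _ ->]; rewrite /halfspace_fun/=;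
  by have := cx i; rewrite ltr_norml => /andP[]; lra.
move=> [/allP h1 /allP h2] i; rewrite ltr_norml.
have /= := h1 (i, 1, r - c ord0 i) ltac:(by apply: map_f; rewrite mem_enum).
have /= := h2 (i, -1, r + c ord0 i) ltac:(by apply: map_f; rewrite mem_enum).
by rewrite /halfspace_fun/=; lra.
Qed.

(** A smooth approximation from below of the indicator of [halfspaces s]: each factor vanishes off
    its half-space and tends to 1 inside it as [k] grows. *)
Definition bump s (k : nat) x : R := \prod_(p <- s) flat 0 (k.+1%:R * halfspace_fun p x).

Lemma flat_algebra_bump s k : flat_algebra (bump s k).
Proof.
apply: flat_algebra_prod => p.
rewrite (_ : (fun _ => _) = (fun x => flat 0 (k.+1%:R * p.1.2 * x ord0 p.1.1 + k.+1%:R * p.2))).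
  exact: flat_algebra_flat.
by apply/funext => x; rewrite /halfspace_fun mulrDr mulrA.
Qed.

Lemma bump_itv01 s k x : 0 <= bump s k x <= 1.
Proof.
rewrite /bump; elim: s => [|p s /andP[IH0 IH1]]; first by rewrite big_nil lexx ler01.
have /andP[f0 f1] := flat0_itv01 (k.+1%:R * halfspace_fun p x).
by rewrite big_cons mulr_ge0//= mulr_ile1.
Qed.

Lemma bump_out s k x : ~ halfspaces s x -> bump s k x = 0.
Proof.
rewrite /halfspaces/= /bump; elim: s => //= p s IH.
rewrite big_cons => /negP; rewrite negb_and => /orP[|/negP/IH ->]; last by rewrite mulr0.
by rewrite -leNgt => p0; rewrite flat_le0 ?mul0r// pmulr_rle0.
Qed.

Lemma cvg_bump s x : bump s k x @[k --> \oo] --> (\1_(halfspaces s) x : R).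
Proof.
have [sx|sx] := pselect (halfspaces s x); last first.
  rewrite indicE memNset// (_ : (fun _ => _) = cst 0); first exact: cvg_cst.
  by apply/funext => k; rewrite bump_out.
rewrite indicE mem_set//; move: sx; rewrite /halfspaces/= /bump.
elim: s => [_|p s IH /= /andP[px sx]].
  by rewrite (_ : (fun _ => _) = cst 1); [exact: cvg_cst|apply/funext => k; rewrite big_nil].
have -> : (fun k => \prod_(q <- p :: s) flat 0 (k.+1%:R * halfspace_fun q x)) =
    (fun k => flat 0 (k.+1%:R * halfspace_fun p x)) \*
    (fun k => \prod_(q <- s) flat 0 (k.+1%:R * halfspace_fun q x)).
  by apply/funext => k /=; rewrite big_cons.
by have := cvgM (cvg_flat0 px) (IH sx); rewrite mulr1; exact.
Qed.

End halfspaces.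

Section density.
Context {R : realType} {n : nat}.
Local Notation mu := (lebesgue_rV n : {measure set 'rV[R]_n -> \bar R}).
Variables (c : 'rV[R]_n) (r : R) (w : 'rV[R]_n -> R).
Local Notation Q := (cube c r).
Hypothesis w_ge0 : forall x, 0 <= w x.
Hypothesis w_int : mu.-integrable Q (EFin \o w).

Let mw : measurable_fun Q w.
Proof. by have /integrableP[/measurable_EFinP] := w_int. Qed.

Let mQ : measurable Q. Proof. exact: measurable_cube. Qed.

(** Dominated convergence, with [w] itself as the dominating function. *)
Lemma dominated_approx (A : set 'rV[R]_n) (g : nat -> 'rV[R]_n -> R) :
  measurable A -> (forall k, measurable_fun setT (g k)) ->
  (forall k x, 0 <= g k x <= 1) ->
  (forall x, Q x -> g k x @[k --> \oo] --> (\1_A x : R)) ->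
  forall e, 0 < e -> exists k, (\int[mu]_(x in Q) (`|g k x - \1_A x| * w x)%:E <= e%:E)%E.
Proof.
move=> mA mg g01 gA e e0.
have [] := @dominated_convergence _ _ R mu Q mQ
   (fun k x => (`|g k x - \1_A x| * w x)%:E) (cst 0%E) (EFin \o w).
- move=> k; apply/measurable_EFinP; apply: measurable_funM => //.
  apply: measurableT_comp => //; apply: measurable_funTS.
  by apply: measurable_funB => //; exact: measurable_indic.
- exact: measurable_cst.
- apply: aeW => x Qx; apply/cvg_EFin; first by near=> k.
  rewrite (_ : 0 = `|(\1_A x : R) - \1_A x| * w x)%R; last by rewrite subrr normr0 mul0r.
  apply: cvgMr_tmp; apply: cvg_norm; apply: cvgB; [exact: gA|exact: cvg_cst].
- exact: w_int.
- apply: aeW => x k Qx; rewrite /= lee_fin normrM normr_id (ger0_norm (w_ge0 _)) ler_piMl//.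
  have /andP[g0 g1] := g01 k x; rewrite indicE ler_norml.
  by case: (x \in A); rewrite /=; lra.
move=> _ _; rewrite integral_cst// mul0e => /fine_cvgP[fin /cvgrPdist_le/(_ _ e0)].
move=> [N _ HN]; move: fin => [M _ HM].
exists (maxn N M).
have := HM (maxn N M) (leq_maxr _ _); have := HN (maxn N M) (leq_maxl _ _).
rewrite /= sub0r normrN => + fin; rewrite -[X in (X <= _)%E]fineK// lee_fin.
by rewrite ger0_norm// fine_ge0// integral_ge0// => x _; rewrite lee_fin mulr_ge0.
Unshelve. all: by end_near. Qed.

(** Approximation in [L^1(Q, w dx)] by bounded functions that vanish off [Q]. The set [A] may leave
    [Q]; only its part inside is approximated. The weight will be [1 + |b|]. *)
Definition approximable (A : set 'rV[R]_n) := forall e : R, 0 < e ->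
  exists f, [/\ flat_algebra f, exists B, forall x, `|f x| <= B,
    (forall x, ~ Q x -> f x = 0) &
    (\int[mu]_(x in Q) (`|f x - \1_A x| * w x)%:E <= e%:E)%E].

Let measurable_dist (f : 'rV[R]_n -> R) (A : set 'rV[R]_n) :
  measurable_fun setT f -> measurable A ->
  measurable_fun Q (fun x => (`|f x - \1_A x| * w x)%:E).
Proof.
move=> mf mA; apply/measurable_EFinP; apply: measurable_funM => //.
apply: measurableT_comp => //; apply: measurable_funTS.
by apply: measurable_funB => //; exact: measurable_indic.
Qed.

(** Dynkin's theorem: finite intersections of half-spaces form a pi-system generating the measurable
    sets, and the approximable measurable sets form a lambda-system. *)
Lemma approximable_measurable (A : set 'rV[R]_n) : measurable A -> approximable A.
Proof.
move=> mA; suff : <<s range (@halfspaces R n) >> `<=` [set A | measurable A /\ approximable A].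
  by move=> /(_ _ (measurable_halfspacesE mA))[].
have halfP s : approximable (halfspaces s).
  (* Appending the half-spaces [t] that define [Q] makes the bumps vanish off [Q] and leaves their
     limit inside [Q] unchanged. *)
  move=> e e0; have [t tE] := cubeE c r.
  have [|k|k x|x Qx|k Hk] := dominated_approx (A := halfspaces s) (g := bump (s ++ t)) _ _ _ _ e0.
  - exact: measurable_halfspaces.
  - by apply: measurable_flat_algebra; exact: flat_algebra_bump.
  - exact: bump_itv01.
  - have := @cvg_bump R n (s ++ t) x; rewrite halfspaces_cat -tE indicI/=.
    have q1 : \1_Q x = 1 :> R by rewrite indicE mem_set.
    by rewrite q1 mulr1.
  exists (bump (s ++ t) k); split => //.
  - exact: flat_algebra_bump.
  - by exists 1 => x; have /andP[h0 h1] := bump_itv01 (s ++ t) k x; rewrite ger0_norm.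
  - by move=> x Qx; rewrite bump_out// halfspaces_cat -tE => -[].
apply: lambda_system_subset.
- move=> _ _ [s _ <-] [t _ <-]; exists (s ++ t) => //; exact: halfspaces_cat.
- split.
  + by [].
  + split => //; rewrite (_ : setT = halfspaces [::])//.
    by apply/seteqP; split.
  (* Proper differences: as [C] lies in [B], the indicator of the difference is the difference of
     the indicators, and approximants are subtracted. *)
  + move=> B C CB [mB aB] [mC aC]; split; first exact: measurableD.
    move=> e e0; have e20 : 0 < e / 2 by rewrite divr_gt0.
    have [f [af [M1 fM1] f0 fe]] := aB _ e20.
    have [g [ag [M2 gM2] g0 ge]] := aC _ e20.
    exists (f + - g); split.
    * by apply: flat_algebraD => //; exact: flat_algebraN.
    * exists (M1 + M2) => x; rewrite !fctE (le_trans (ler_normB _ _))//.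
      by rewrite lerD.
    * by move=> x Qx; rewrite !fctE f0// g0// subrr.
    have mf := measurable_flat_algebra af; have mg := measurable_flat_algebra ag.
    rewrite (@le_trans _ _ (\int[mu]_(x in Q) ((`|f x - \1_B x| * w x)%:E +
       (`|g x - \1_C x| * w x)%:E))%E)//.
      apply: ge0_le_integral => //.
      - by move=> x _; rewrite lee_fin mulr_ge0.
      - apply: measurable_dist; [exact: measurable_funB|exact: measurableD].
      - by apply: emeasurable_funD; exact: measurable_dist.
      - move=> x _; rewrite -EFinD lee_fin -mulrDl ler_wpM2r// !fctE.
        have -> : (\1_(B `\` C) x : R) = \1_B x - \1_C x.
          rewrite !indicE in_setD; have [xC|xC] := boolP (x \in C).
            by rewrite andbF (mem_set (CB _ (set_mem xC))) subrr.
          by rewrite andbT subr0.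
        by rewrite (_ : _ - _ = f x - \1_B x - (g x - \1_C x)) ?ler_normB//; ring.
    rewrite ge0_integralD//; last 4 first.
    * by move=> x _; rewrite lee_fin mulr_ge0.
    * exact: measurable_dist.
    * by move=> x _; rewrite lee_fin mulr_ge0.
    * exact: measurable_dist.
    by rewrite (splitr e) EFinD leeD.
  (* Increasing unions: some [F k] is within [e / 2] of the union in weighted measure, and an
     approximant of that [F k] serves for the union. *)
  + move=> F ndF HF.
    have mF k : measurable (F k) by case: (HF k).
    have mU : measurable (\bigcup_k F k) by exact: bigcup_measurable.
    split => // e e0; have e20 : 0 < e / 2 by rewrite divr_gt0.
    have [||k x|x Qx|k Hk] := dominated_approx (A := \bigcup_k F k)
      (g := fun k => \1_(F k)) _ _ _ _ e20.
    * by [].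
    * by move=> k; exact: measurable_indic.
    * by rewrite indicE; case: (_ \in _); rewrite lexx ler01.
    * apply: cvg_near_cst; have [[k0 _ Fx]|Ux] := pselect ((\bigcup_k F k) x).
        exists k0 => // k /= k0k; rewrite !indicE !mem_set//; first by exists k0.
        by have /subsetPset := ndF _ _ k0k; exact.
      by apply: nearW => k; rewrite !indicE !memNset// => Fx; apply: Ux; exists k.
    have [_ /(_ _ e20)[f [af Bf f0 fe]]] := HF k.
    exists f; split => //.
    have mf := measurable_flat_algebra af.
    rewrite (@le_trans _ _ (\int[mu]_(x in Q) ((`|f x - \1_(F k) x| * w x)%:E +
       (`|\1_(F k) x - \1_(\bigcup_k F k) x| * w x)%:E))%E)//.
      apply: ge0_le_integral => //.
      - by move=> x _; rewrite lee_fin mulr_ge0.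
      - exact: measurable_dist.
      - by apply: emeasurable_funD; apply: measurable_dist => //; exact: measurable_indic.
      - move=> x _; rewrite -EFinD lee_fin -mulrDl ler_wpM2r//.
        by rewrite -(subrKA (\1_(F k) x)) ler_normD.
    rewrite ge0_integralD//; last 4 first.
    * by move=> x _; rewrite lee_fin mulr_ge0.
    * exact: measurable_dist.
    * by move=> x _; rewrite lee_fin mulr_ge0.
    * by apply: measurable_dist => //; exact: measurable_indic.
    by rewrite (splitr e) EFinD leeD.
- by move=> _ [s _ <-]; split; [exact: measurable_halfspaces|exact: halfP].
- by [].
Qed.

End density.

(** * The commutator away from the support *)

Section cube_measure.
Context {R : realType} {n : nat}.
Local Notation mu := (lebesgue_rV n : {measure set 'rV[R]_n -> \bar R}).
Implicit Types (c x : 'rV[R]_n) (b : 'rV[R]_n -> R).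

Lemma lebesgue_cube_fin c r : 0 < r -> (mu (cube c r) < +oo)%E.
Proof.
(* The map [s *: x + v] sends [c] to the point with all coordinates [1 / 2], and the cube into the
   unit box. *)
move=> r0; pose s := (2 * r)^-1; have s0 : 0 < s by rewrite invr_gt0 mulr_gt0.
pose v : 'rV[R]_n := \row_i (2^-1 - s * c ord0 i).
have mU : measurable (box 0 (0 + 1) : set 'rV[R]_n) by exact: measurable_box.
have mV : measurable ((fun x : 'rV[R]_n => s *: x + v) @^-1` box 0 (0 + 1)).
  by rewrite -[_ @^-1` _]setTI; exact: measurable_rV_affine.
have := lebesgue_rV_affine v s0 mU; rewrite lebesgue_rV_unit_box => H.
apply: (@le_lt_trans _ _ (mu ((fun x : 'rV[R]_n => s *: x + v) @^-1` box 0 (0 + 1)))).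
  apply: le_measure; rewrite ?inE//; first exact: measurable_cube.
  move=> x cx i; have := cx i; rewrite !mxE/= add0r.
  rewrite -(ltr_pM2l s0) (_ : s * r = 2^-1); last by rewrite /s; field; rewrite gt_eqF.
  by rewrite -{1}(gtr0_norm s0) -normrM ltr_norml mulrBr => /andP[]; lra.
rewrite ltey; apply/eqP => E; move: H; rewrite [X in (_ * X)%E]E.
by rewrite gt0_muley// lte_fin exprn_gt0.
Qed.

(** Local integrability speaks of compact sets, so for [|b|] the open cube is enlarged to the closed
    one. *)
Lemma loc_integrable_cube b c r : loc_integrable b -> 0 < r ->
  mu.-integrable (cube c r) (EFin \o (fun x => 1 + `|b x|)).
Proof.
move=> [mb bint] r0; have mQ : measurable (cube c r) by exact: measurable_cube.
have i1 : mu.-integrable (cube c r) (EFin \o cst 1).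
  apply: measurable_bounded_integrable => //; first exact: lebesgue_cube_fin.
  exact: bounded_cst.
have i2 : mu.-integrable (cube c r) (EFin \o (fun x => `|b x|)).
  apply/integrableP; split.
    by apply/measurable_EFinP; apply: measurableT_comp => //; exact: measurable_funTS.
  pose K := [set x : 'rV[R]_n | forall i, `[c ord0 i - r, c ord0 i + r]%classic (x ord0 i)].
  have /bint : compact K.
    apply: (@rV_compact R n (fun i => `[c ord0 i - r, c ord0 i + r]%classic)) => i.
    exact: segment_compact.
  apply: le_lt_trans; under eq_integral do rewrite /= normr_id.
  apply: ge0_subset_integral => //.
  - apply: (measurable_rV_prod (J := fun i => `[c ord0 i - r, c ord0 i + r]%classic)) => i.
    exact: measurable_itv.
  - by apply: measurable_funTS; apply/measurable_EFinP; exact: measurableT_comp.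
  - by move=> x h i; rewrite /= in_itv/= -ler_distl ltW.
exact: (integrableD mQ i1 i2).
Qed.

End cube_measure.

Section off_support.
Context {R : realType} {n : nat}.
Local Notation mu := (lebesgue_rV n : {measure set 'rV[R]_n -> \bar R}).
Variables (Omega b : 'rV[R]_n -> R) (y x : 'rV[R]_n) (r d B : R).
Hypothesis mOmega : measurable_fun setT Omega.
Hypothesis Omega_le : forall u, u != 0 -> `|Omega u| <= B.
Hypothesis b_int : loc_integrable b.
Hypothesis r0 : 0 < r.
Hypothesis rd : r < d.
Hypothesis xy : d <= `|x - y|.
Local Notation Q := (cube y r).
Local Notation K := (sing_kernel Omega).

Lemma off_support_dist z : Q z -> d - r < enorm (x - z).
Proof.
move=> /cube_norm/(_ r0) zr; rewrite (lt_le_trans _ (norm_le_enorm _))//.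
rewrite distrC in zr; have := lerB_normD (x - y) (y - z); rewrite addrA subrK.
by move: xy zr; lra.
Qed.

Lemma off_support_neq0 z : Q z -> x - z != 0.
Proof. by move=> /off_support_dist h; rewrite -enorm_gt0 (lt_trans _ h)// subr_gt0. Qed.

Lemma sing_kernel_le z : Q z -> `|K (x - z)| <= B / (d - r) ^+ n.
Proof.
move=> Qz; have h := off_support_dist Qz; have dr : 0 < d - r by rewrite subr_gt0.
rewrite /sing_kernel normrM normfV (ger0_norm (exprn_ge0 _ (enorm_ge0 _))).
rewrite ler_pM ?invr_ge0 ?exprn_ge0 ?enorm_ge0 ?Omega_le ?off_support_neq0//.
rewrite lef_pV2 ?posrE ?exprn_gt0// ?(lt_trans dr)//.
by rewrite lerXn2r ?nnegrE ?enorm_ge0 ?ltW.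
Qed.

Lemma measurable_sing_kernel : measurable_fun setT (fun z : 'rV[R]_n => K (x - z)).
Proof.
have mx : measurable_fun setT (fun z : 'rV[R]_n => x - z).
  rewrite (_ : (fun _ => _) = (fun z => -1 *: z + x)); first exact: measurable_rV_affine.
  by apply/funext => z; rewrite scaleN1r addrC.
suff mK : measurable_fun setT K by exact: measurableT_comp.
rewrite (_ : K = Omega \* (@powR R ^~ (- n%:R) \o enorm)); last first.
  by apply/funext => z; rewrite /= powRN powR_mulrn ?enorm_ge0.
apply: measurable_funM => //.
by apply: measurableT_comp; [exact: measurable_powR|exact: measurable_enorm].
Qed.

(** Every point of [Q] is at Euclidean distance more than [d - r] from [x]; a truncation below
    [d - r] removes nothing, and the limit is that of an eventually constant function. *)
Lemma sio_off_support g : (forall z : 'rV[R]_n, ~ Q z -> g z = 0) ->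
  sio Omega g x = \int[mu]_(z in Q) (K (x - z) * g z).
Proof.
move=> g0; rewrite /sio; apply: lim_near_cst => //.
have dr : 0 < d - r by rewrite subr_gt0.
near=> e; have ed : e < d - r by near: e; exact: nbhs_right_lt.
rewrite /truncated_sio [LHS]Rintegral_mkcond [RHS]Rintegral_mkcond.
apply: eq_Rintegral => z _; rewrite /restrict.
have [Qz|Qz] := pselect (Q z); last first.
  by rewrite (memNset Qz) g0// mulr0; case: ifP.
by rewrite (mem_set Qz) mem_set//= (lt_trans ed)// off_support_dist.
Unshelve. all: by end_near. Qed.

Lemma dominated_integrable (g : 'rV[R]_n -> R) (C : R) : measurable_fun setT g ->
  (forall z, Q z -> `|g z| <= C * (1 + `|b z|)) -> mu.-integrable Q (EFin \o g).
Proof.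
move=> mg gC; have mQ : measurable Q by exact: measurable_cube.
have iw := integrableZl mQ C (loc_integrable_cube y b_int r0).
apply: le_integrable iw => //; first by apply/measurable_EFinP; exact: measurable_funTS.
by move=> z Qz; rewrite lee_fin (le_trans (gC _ Qz))//= ler_norm.
Qed.

(** On [Q] the kernel is bounded and [b] is integrable, so both singular integrals converge
    absolutely and combine into one. *)
Lemma commutator_off_support (f : 'rV[R]_n -> R) :
  measurable_fun setT f -> (exists M, forall z, `|f z| <= M) ->
  (forall z : 'rV[R]_n, ~ Q z -> f z = 0) ->
  commutator b Omega f x = \int[mu]_(z in Q) (K (x - z) * (b z - b x) * f z).
Proof.
move=> mf [M fM] f0; rewrite /commutator sio_off_support; last first.
  by move=> z Qz; rewrite /= f0// mulr0.
rewrite sio_off_support//.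
have mQ : measurable Q by exact: measurable_cube.
have [mb _] := b_int.
have Kf z : Q z -> `|K (x - z) * f z| <= B / (d - r) ^+ n * M.
  by move=> Qz; rewrite normrM ler_pM// sing_kernel_le.
have mKf : measurable_fun setT (fun z : 'rV[R]_n => K (x - z) * f z).
  by apply: measurable_funM => //; exact: measurable_sing_kernel.
have iKf : mu.-integrable Q (EFin \o (fun z : 'rV[R]_n => K (x - z) * f z)).
  apply: (dominated_integrable (C := B / (d - r) ^+ n * M)) => // z Qz.
  rewrite (le_trans (Kf _ Qz))//.
  rewrite ler_peMr ?lerDl// (le_trans _ (Kf _ Qz))//.
have iKbf : mu.-integrable Q (EFin \o (fun z : 'rV[R]_n => K (x - z) * (b \* f) z)).
  rewrite (_ : (fun _ => _) = (fun z : 'rV[R]_n => K (x - z) * f z * b z)); last first.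
    by apply/funext => z /=; ring.
  apply: (dominated_integrable (C := B / (d - r) ^+ n * M)); first exact: measurable_funM.
  move=> z Qz; rewrite normrM ler_pM ?Kf// lerDr//.
rewrite -RintegralZl// -RintegralB//; last first.
  exact: (integrableZl mQ (b x) iKf).
by apply: eq_Rintegral => z _ /=; ring.
Qed.

(** Replacing [f] by the indicator of [E] gives the main term; the sign [sg] excludes cancellation
    over [E]. Since [|K (x - z) * (b z - b x)|] is at most a constant times [1 + |b z|], the error
    is controlled by the distance of [f] to the indicator in this weight, which dictates its
    choice. *)
Lemma commutator_lower_bound (f : 'rV[R]_n -> R) (E : set 'rV[R]_n) (sg a M e : R) :
  measurable_fun setT f -> (exists M', forall z, `|f z| <= M') ->
  (forall z, ~ Q z -> f z = 0) ->
  measurable E -> E `<=` Q -> `|sg| = 1 -> `|b x| <= M ->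
  (forall z, E z -> a <= sg * (K (x - z) * (b z - b x))) ->
  (\int[mu]_(z in Q) (`|f z - \1_E z| * (1 + `|b z|))%:E <= e%:E)%E ->
  a * fine (mu E) - B / (d - r) ^+ n * (1 + M) * e <= `|commutator b Omega f x|.
Proof.
move=> mf fb f0 mE EQ sg1 bM aE fe.
have [M' fM] := fb; have [mb _] := b_int.
have mQ : measurable Q by exact: measurable_cube.
have M0 : 0 <= M by rewrite (le_trans _ bM).
set H := B / (d - r) ^+ n * (1 + M).
pose G z := K (x - z) * (b z - b x).
have GH z : Q z -> `|G z| <= H * (1 + `|b z|).
  move=> Qz; rewrite normrM /H -mulrA ler_pM ?sing_kernel_le//.
  rewrite (le_trans (ler_normB _ _))// mulrDr mulr1 mulrDl mul1r.
  by have := mulr_ge0 M0 (normr_ge0 (b z)); move: bM; lra.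
have mG : measurable_fun setT G.
  apply: measurable_funM; first exact: measurable_sing_kernel.
  by apply: measurable_funB => //; exact: measurable_cst.
have mfE : measurable_fun setT (fun z => f z - \1_E z).
  by apply: measurable_funB => //; exact: measurable_indic.
have mdist : measurable_fun setT (fun z => `|f z - \1_E z| * (1 + `|b z|)).
  apply: measurable_funM; first exact: measurableT_comp.
  by apply: measurable_funD; [exact: measurable_cst|exact: measurableT_comp].
have fE z : `|f z - \1_E z| <= M' + 1.
  rewrite (le_trans (ler_normB _ _))// lerD// indicE.
  by case: (_ \in _); rewrite ?normr1 ?normr0.
have idist : mu.-integrable Q (EFin \o (fun z => `|f z - \1_E z| * (1 + `|b z|))).
  apply: (dominated_integrable (C := M' + 1)) => // z Qz.
  by rewrite normrM normr_id (@ger0_norm _ (1 + _)) ?addr_ge0// ler_wpM2r ?addr_ge0.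
have iE : mu.-integrable Q (EFin \o (\1_E : 'rV[R]_n -> R)).
  apply: (dominated_integrable (C := 1)); first exact: measurable_indic.
  move=> z Qz; rewrite mul1r indicE; have := normr_ge0 (b z).
  by case: (_ \in _); rewrite /= ?normr1 ?normr0; lra.
have iGf : mu.-integrable Q (EFin \o (fun z => sg * (G z * f z))).
  apply: (dominated_integrable (C := H * M')).
    by apply: measurable_funM; [exact: measurable_cst|exact: measurable_funM].
  move=> z Qz; rewrite (normrM sg) (normrM (G z)) sg1 mul1r [leRHS]mulrAC.
  by rewrite ler_pM// GH.
have iGf' : mu.-integrable Q (EFin \o (fun z => G z * f z)).
  apply: (dominated_integrable (C := H * M')); first exact: measurable_funM.
  by move=> z Qz; rewrite (normrM (G z)) [leRHS]mulrAC ler_pM// GH.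
rewrite commutator_off_support// -/G -[leRHS]mul1r -sg1 -normrM -RintegralZl//.
apply: le_trans (ler_norm _).
have iaE : mu.-integrable Q (EFin \o (fun z => a * (\1_E z : R))).
  exact: (integrableZl mQ a iE).
have iHd : mu.-integrable Q (EFin \o (fun z => H * (`|f z - \1_E z| * (1 + `|b z|)))).
  exact: (integrableZl mQ H idist).
apply: (@le_trans _ _ (\int[mu]_(z in Q)
    (a * \1_E z - H * (`|f z - \1_E z| * (1 + `|b z|))))); last first.
  apply: le_Rintegral => //; first exact: (integrableB mQ iaE iHd).
  move=> z Qz.
  have -> : sg * (G z * f z) = sg * G z * \1_E z + sg * (G z * (f z - \1_E z)) by ring.
  rewrite lerD//.
    rewrite indicE; have [zE|zE] := boolP (z \in E); last by rewrite !mulr0.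
    by rewrite !mulr1 aE//; exact: set_mem.
  rewrite lerNnormlW// (normrM sg) (normrM (G z)) sg1 mul1r mulrCA (mulrC `|G z|).
  by rewrite ler_wpM2l// GH.
have H0 : 0 <= H.
  have Qy : Q y by move=> i; rewrite subrr normr0.
  have := le_trans (normr_ge0 _) (GH _ Qy).
  by rewrite pmulr_lge0// ltr_wpDr.
rewrite RintegralB// !RintegralZl// lerB//.
  rewrite /Rintegral; have -> : (\int[mu]_(z in Q) (\1_E z)%:E)%E = mu E.
    by rewrite integral_indic// setIidl.
  by [].
rewrite ler_wpM2l// /Rintegral -lee_fin fineK//.
exact: integrable_fin_num.
Qed.

End off_support.

(** * The weak type inequality tested on approximate indicators *)

Section weak_type.
Context {R : realType} {n : nat}.
Local Notation mu := (lebesgue_rV n : {measure set 'rV[R]_n -> \bar R}).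
Variables (Omega b : 'rV[R]_n -> R) (B N : R).
Hypothesis mOmega : measurable_fun setT Omega.
Hypothesis B0 : 0 <= B.
Hypothesis Omega_le : forall u, u != 0 -> `|Omega u| <= B.
Hypothesis b_int : loc_integrable b.
Hypothesis N0 : 0 <= N.
Hypothesis weakN : weak_type11_bound b Omega N.
Local Notation K := (sing_kernel Omega).

Lemma test_function_flat_algebra (y : 'rV[R]_n) r f : 0 < r -> flat_algebra f ->
  (forall z, ~ cube y r z -> f z = 0) -> test_function f.
Proof.
move=> r0 af f0; split; first exact: smooth_flat_algebra.
exists (n%:R * (`|y| + r)) => x xM; apply: f0 => /cube_norm/(_ r0) xy.
move: xM; apply/negP; rewrite -leNgt (le_trans (enorm_le_norm _))// ler_wpM2l//.
by rewrite -[x](subrK y) (le_trans (ler_normD _ _))// addrC lerD2l ltW.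
Qed.

(** Let [m] be the measure of [E] and [f] close to the indicator of [E]: the norm of [f] is at most
    [2 * m], and the commutator exceeds [a * m / 2] on [G]. In the weak type inequality [m] cancels,
    so [E] may be arbitrarily small; [M] affects only how close [f] must be. *)
Lemma weak_type_lower_bound (y : 'rV[R]_n) (r d a M : R) (E G : set 'rV[R]_n) :
  0 < r -> r < d -> 0 < a -> measurable E -> E `<=` cube y r -> (0 < mu E)%E ->
  measurable G ->
  (forall x, G x -> [/\ d <= `|x - y|, `|b x| <= M & exists2 sg, `|sg| = 1 &
     forall z, E z -> a <= sg * (K (x - z) * (b z - b x))]) ->
  (a%:E * mu G <= (4 * N)%:E)%E.
Proof.
move=> r0 rd a0 mE EQ E0 mG GP.
have [[x0 Gx0]|/nonemptyPn ->] := pselect (G !=set0); last first.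
  by rewrite measure0 mule0 lee_fin mulr_ge0.
have M0 : 0 <= M by have [_ bM _] := GP _ Gx0; exact: le_trans (normr_ge0 _) bM.
have mQ : measurable (cube y r) by exact: measurable_cube.
have Efin : mu E \is a fin_num.
  rewrite ge0_fin_numE// (le_lt_trans _ (lebesgue_cube_fin y r0))//.
  by apply: le_measure; rewrite ?inE.
set m := fine (mu E); have m0 : 0 < m by rewrite fine_gt0// E0 -ge0_fin_numE.
set H := B / (d - r) ^+ n * (1 + M).
have H0 : 0 <= H.
  by rewrite mulr_ge0 ?divr_ge0 ?exprn_ge0 ?subr_ge0 ?(ltW rd)// addr_ge0.
(* The bound by [m] keeps the norm of [f] below [2 * m]; the other one makes the error [H * e] at
   most [a * m / 4]. Using [H + 1] avoids a zero denominator. *)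
pose e := Num.min m (a * m / (4 * (H + 1))).
have H1 : 0 < H + 1 by rewrite ltr_wpDl.
have e0 : 0 < e by rewrite lt_min m0 divr_gt0// mulr_gt0.
have He : H * e <= a * m / 4.
  rewrite (@le_trans _ _ ((H + 1) * e))// ?ler_wpM2r ?lerDl ?(ltW e0)//.
  have em : e <= a * m / (4 * (H + 1)) by rewrite ge_min lexx orbT.
  rewrite (le_trans (ler_wpM2l (ltW H1) em))//.
  by rewrite le_eqVlt; apply/orP; left; apply/eqP; field; rewrite gt_eqF.
have w0 z : 0 <= 1 + `|b z| by rewrite addr_ge0.
have [f [af fb f0 fe]] := approximable_measurable w0 (loc_integrable_cube y b_int r0) mE e0.
have mf := measurable_flat_algebra af.
have am0 : 0 < a * m / 2 by rewrite divr_gt0// mulr_gt0.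
have := weakN (test_function_flat_algebra r0 af f0) am0.
have Gsub : G `<=` [set x | a * m / 2 < `|commutator b Omega f x|].
  move=> x Gx /=; have [xy bM [sg sg1 aE]] := GP x Gx.
  have := commutator_lower_bound mOmega Omega_le b_int r0 rd xy mf fb f0 mE EQ sg1 bM aE fe.
  apply: lt_le_trans; rewrite -/m -/H; move: He am0; lra.
(* Monotonicity of the outer measure passes from the level set to its measurable subset [G], on
   which the outer measure is Lebesgue measure. *)
move=> /(le_trans (lee_wpmul2l _ (le_mu_ext mu Gsub))).
rewrite measurable_mu_extE// Lnorm1 => /(_ _) W.
have {W} : ((a * m / 2)%:E * mu G <= N%:E * (2 * m)%:E)%E.
  apply: (le_trans (W _)); first by rewrite lee_fin ltW.
  apply: lee_wpmul2l; first by rewrite lee_fin.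
  have -> : (\int[mu]_x `|(EFin \o f) x| = \int[mu]_(x in cube y r) `|f x|%:E)%E.
    rewrite [RHS]integral_mkcond; apply: eq_integral => z _; rewrite /restrict.
    case: ifPn => // zQ; rewrite /= f0 ?normr0// => /mem_set; exact/negP.
  have mfE : measurable_fun (cube y r) (fun z => (`|f z - \1_E z| * (1 + `|b z|))%:E).
    have [mb _] := b_int.
    apply: measurable_funTS; apply/measurable_EFinP; apply: measurable_funM.
      by apply: measurableT_comp => //; apply: measurable_funB => //; exact: measurable_indic.
    by apply: measurable_funD; [exact: measurable_cst|exact: measurableT_comp].
  have m1E : measurable_fun (cube y r) (fun z => (\1_E z : R)%:E).
    by apply: measurable_funTS; apply/measurable_EFinP; exact: measurable_indic.
  rewrite (@le_trans _ _ (\int[mu]_(z in cube y r)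
      ((\1_E z)%:E + (`|f z - \1_E z| * (1 + `|b z|))%:E))%E)//.
    apply: ge0_le_integral => //.
    - by apply: measurable_funTS; apply/measurable_EFinP; exact: measurableT_comp.
    - exact: emeasurable_funD.
    - move=> z _; rewrite -EFinD lee_fin -{1}(subrK (\1_E z) (f z)).
      rewrite (le_trans (ler_normD _ _))// addrC (@ger0_norm _ (\1_E z))// lerD2l.
      by rewrite ler_peMr// lerDl.
  rewrite ge0_integralD//.
  rewrite integral_indic// setIidl// mulr_natl mulr2n EFinD.
  rewrite -[X in (X + _ <= _)%E](fineK Efin) -/m.
  by rewrite leeD2l// (le_trans fe)// lee_fin ge_min lexx.
move=> W; have m2 : (0 <= (2 / m)%:E)%E by rewrite lee_fin divr_ge0// ltW.
have := lee_wpmul2l m2 W; rewrite muleA -!EFinM.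
by congr (_%:E * _ <= _%:E)%E; field; rewrite gt_eqF.
Qed.

End weak_type.

(** * The oscillation of b *)

(** One sign, that of [u], serves for all [v] near [u]; this is applied below to values of [Omega]
    and to differences of [b]. *)
Lemma sgr_mul_ge (R : realDomainType) (u v e : R) : `|u - v| <= e -> `|u| - e <= Num.sg u * v.
Proof.
move=> uv; have [u0|u0|->] := ltgtP u 0.
- by rewrite ltr0_sg// mulN1r ltr0_norm//; move: uv; rewrite ler_norml => /andP[]; lra.
- by rewrite gtr0_sg// mul1r gtr0_norm//; move: uv; rewrite ler_norml => /andP[]; lra.
- by rewrite sgr0 mul0r normr0 sub0r oppr_le0 (le_trans _ uv).
Qed.

Section oscillation.
Context {R : realType} {n : nat}.
Local Notation mu := (lebesgue_rV n : {measure set 'rV[R]_n -> \bar R}).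
Variables (Omega b : 'rV[R]_n -> R) (B L N : R).
Hypothesis n0 : (0 < n)%N.
Hypothesis mOmega : measurable_fun setT Omega.
Hypothesis B0 : 0 <= B.
Hypothesis Omega_le : forall u, u != 0 -> `|Omega u| <= B.
Hypothesis L0 : 0 < L.
Hypothesis Omega_lip : forall u v, u != 0 -> v != 0 ->
  `|Omega u - Omega v| <= L * `|u - v| / `|u|.
Hypothesis b_int : loc_integrable b.
Hypothesis N0 : 0 <= N.
Hypothesis weakN : weak_type11_bound b Omega N.

(** Weaker than approximate continuity of [b] at [y]: positive measure is all that is asked, because
    the measure of this set cancels in [weak_type_lower_bound]. *)
Definition essential_value (y : 'rV[R]_n) := forall r, 0 < r ->
  (0 < mu (cube y r `&` [set z | (`|b z - b y| < r)%R]))%E.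

(** For [x] in [G] and [z] near [y] with [b z] near [b y], the kernel is at least
    [(delta / 2) / (5 n r)^n] in size and [b z - b x] at least [D / 4], both with the signs they
    have at [z = y]. Here [5 n r] bounds the Euclidean length of [x - z]. *)
Lemma far_set_bound (y : 'rV[R]_n) (r delta D M : R) (G : set 'rV[R]_n) :
  essential_value y -> 0 < r -> 0 < delta -> 0 < D -> measurable G ->
  (forall x, G x -> [/\ r <= `|x - y| <= 4 * r, delta < `|Omega (x - y)|,
     `|b x| <= M & D / 2 <= `|b x - b y|]) ->
  ((delta / 2 / (5 * n%:R * r) ^+ n * (D / 4))%:E * mu G <= (4 * N)%:E)%E.
Proof.
move=> ess r0 d0 D0 mG GP.
have [mb _] := b_int.
(* The three bounds on [s] let [|b z - b x|] lose at most [D / 4], keep [z] away from [x], and, by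
   the Lipschitz estimate, let [|Omega|] lose at most [delta / 2]. *)
pose s := Num.min (D / 4) (Num.min (r / 2) (r * (delta / 2) / L)).
have s0 : 0 < s by rewrite !lt_min !divr_gt0// mulr_gt0// divr_gt0.
have sD : s <= D / 4 by rewrite ge_min lexx.
have sr : s <= r / 2 by rewrite ge_min [in X in _ || X]ge_min lexx orbT.
have sL : s <= r * (delta / 2) / L by rewrite ge_min [in X in _ || X]ge_min lexx !orbT.
have nR : 0 < n%:R :> R by rewrite ltr0n.
have mset : measurable [set z | `|b z - b y| < s].
  rewrite (_ : [set _ | _] = setT `&` b @^-1` `]b y - s, b y + s[).
    by apply: mb => //; exact: measurable_itv.
  by apply/seteqP; split => z; rewrite /= in_itv/= ltr_distl//; case.
apply: (weak_type_lower_bound mOmega B0 Omega_le b_int N0 weakN (y := y) (r := s) (d := r)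
    (M := M) (E := cube y s `&` [set z | `|b z - b y| < s])) => //.
- by rewrite (le_lt_trans sr)// ltr_pdivrMr// ltr_pMr// ltr1n.
- by rewrite mulr_gt0 ?divr_gt0 ?exprn_gt0 ?mulr_gt0.
- by apply: measurableI => //; exact: measurable_cube.
- exact: ess.
move=> x Gx; have [/andP[rx xr] dx bM Dx] := GP x Gx; split => //.
exists (Num.sg (Omega (x - y)) * Num.sg (b y - b x)).
  rewrite normrM !normr_sg -normr_gt0 (lt_trans d0 dx)/= -normr_gt0 distrC.
  by rewrite (lt_le_trans _ Dx) ?mulr1// divr_gt0.
move=> z [/cube_norm/(_ s0) zs /= bz].
have xy0 : x - y != 0 by rewrite -normr_gt0 (lt_le_trans r0).
have xyz : (x - y) - (x - z) = z - y by rewrite opprB addrC subrKA.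
have xz_le : `|x - z| <= 5 * r.
  rewrite (_ : x - z = (x - y) - (z - y)); last by rewrite -xyz subKr.
  by rewrite (le_trans (ler_normB _ _))//; lra.
have xz0 : x - z != 0.
  by apply: contraTneq zs => h; rewrite -xyz h subr0 -leNgt; lra.
have h1 : delta / 2 <= Num.sg (Omega (x - y)) * Omega (x - z).
  have : `|Omega (x - y) - Omega (x - z)| <= delta / 2.
    rewrite (le_trans (Omega_lip xy0 xz0))// xyz ler_pdivrMr ?normr_gt0//.
    rewrite -ler_pdivlMl// mulrC (le_trans (ltW zs))// (le_trans sL)//.
    by rewrite ler_wpM2r ?invr_ge0 ?(ltW L0)// mulrC ler_wpM2l// divr_ge0// ltW.
  by move=> /sgr_mul_ge; apply: le_trans; lra.
have h2 : D / 4 <= Num.sg (b y - b x) * (b z - b x).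
  have : `|b y - b x - (b z - b x)| <= D / 4.
    by rewrite opprB subrKA distrC (le_trans (ltW bz)).
  by move=> /sgr_mul_ge; apply: le_trans; rewrite distrC; lra.
rewrite [leRHS](_ : _ = Num.sg (Omega (x - y)) * Omega (x - z) / enorm (x - z) ^+ n *
    (Num.sg (b y - b x) * (b z - b x))); last by rewrite /sing_kernel; ring.
have ez : 0 < enorm (x - z) by rewrite enorm_gt0.
rewrite ler_pM ?divr_ge0 ?exprn_ge0 ?(ltW d0) ?(ltW D0) ?mulr_ge0 ?(ltW r0)//.
rewrite ler_pM ?invr_ge0 ?exprn_ge0 ?divr_ge0 ?(ltW d0) ?mulr_ge0 ?(ltW r0)//.
rewrite lef_pV2 ?posrE ?exprn_gt0 ?mulr_gt0//.
rewrite lerXn2r ?nnegrE ?(ltW ez) ?mulr_ge0 ?(ltW r0)//.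
by rewrite (le_trans (enorm_le_norm _))// -mulrA mulrCA ler_wpM2l.
Qed.

End oscillation.

(** * Almost every point is an essential value *)

Section negligible_fibers.
Context {R : realType} {n : nat}.
Local Notation mu := (lebesgue_rV n : {measure set 'rV[R]_n -> \bar R}).

(* The exceptional set is covered by the countably many null preimages of
   rational cubes. *)
Lemma ae_preimage_cube_gt0 m (g : 'rV[R]_n -> 'rV[R]_m) : measurable_fun setT g ->
  {ae mu, forall y, forall r, 0 < r -> (0 < mu (g @^-1` cube (g y) r))%E}.
Proof.
move=> mg.
pose T (p : 'rV[rat]_m * nat) := g @^-1` cube (map_mx ratr p.1 : 'rV[R]_m) p.2.+1%:R^-1.
have mT p : measurable (T p).
  by rewrite /T -[_ @^-1` _]setTI; apply: mg => //; exact: measurable_cube.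
pose F k := if unpickle k is Some p then
  (if mu (T p) == 0%E then T p else set0) else set0.
have negF k : mu.-negligible (F k).
  rewrite /F; case: unpickle => [p|]; last exact: negligible_set0.
  case: ifPn => [/eqP Tp0|_]; last exact: negligible_set0.
  exact/negligibleP.
apply: negligibleS (negligible_bigcup negF) => y /= /existsNP[r /not_implyP[r0 /negP]].
rewrite -leNgt => yr.
have [p [yp pr]] := rational_cube (g y) r0.
exists (pickle p) => //; rewrite /F pickleK.
suff -> : mu (T p) == 0%E by exact: yp.
rewrite eq_le measure_ge0 andbT (le_trans _ yr)// le_measure ?inE//.
  by rewrite -[_ @^-1` _]setTI; apply: mg => //; exact: measurable_cube.
by move=> z; exact: pr.
Qed.

(** The preceding lemma is applied to the graph map of [b] into dimension [n.+1]: the preimage of a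
    cube about the graph point over [y] lies in the set of the definition. *)
Lemma ae_essential_value (b : 'rV[R]_n -> R) : measurable_fun setT b ->
  {ae mu, forall y, essential_value b y}.
Proof.
move=> mb; pose g z := rV_cons (b z, z).
have mg : measurable_fun setT g.
  apply: (measurableT_comp (@measurable_rV_cons R n)).
  by apply/measurable_fun_pairP; split => //; exact: measurable_id.
have ge z i : g z ord0 (rshift 1 i) = z ord0 i.
  have [_ e2] := rV_consK (b z, z); by rewrite -[in RHS]e2 [RHS]mxE.
have g0 z : g z ord0 ord0 = b z by have [e1 _] := rV_consK (b z, z).
apply: filterS (ae_preimage_cube_gt0 mg) => y gy r r0.
rewrite (lt_le_trans (gy r r0))// le_measure ?inE//.
- by rewrite -[_ @^-1` _]setTI; apply: mg => //; exact: measurable_cube.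
- apply: measurableI; first exact: measurable_cube.
  rewrite (_ : [set _ | _] = setT `&` b @^-1` `]b y - r, b y + r[).
    by apply: mb => //; exact: measurable_itv.
  by apply/seteqP; split => z; rewrite /= in_itv/= ltr_distl//; case.
- move=> z gz; split => [i|] /=; first by have := gz (rshift 1 i); rewrite !ge.
  by have := gz ord0; rewrite !g0.
Qed.

End negligible_fibers.

Lemma nonincreasing_measure_le d (T : measurableType d) (R : realType)
    (mu : {measure set T -> \bar R}) (S : (set T)^nat) (e : R) :
  (mu (S 0%N) < +oo)%E -> (forall k, measurable (S k)) -> nonincreasing_seq S ->
  mu (\bigcap_k S k) = 0%E -> 0 < e -> exists k, (mu (S k) <= e%:E)%E.
Proof.
move=> Sfin mS niS S0 e0.
have := nonincreasing_cvg_mu Sfin mS (bigcapT_measurable mS) niS.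
rewrite S0 => /fine_cvgP[[M _ HM] /cvgrPdist_le/(_ _ e0)[K _ HK]].
exists (maxn M K); have := HM _ (leq_maxl M K); have := HK _ (leq_maxr M K).
rewrite /= sub0r normrN => h fin; rewrite -(fineK fin) lee_fin.
by rewrite (le_trans _ h)// ler_norm.
Qed.

(** * Exceptional sets of small measure *)

Section small_values.
Context {R : realType} {n : nat}.
Local Notation mu := (lebesgue_rV n : {measure set 'rV[R]_n -> \bar R}).

Lemma box_cube (s t : R) : (box s t : set 'rV[R]_n) `<=` cube 0 (`|s| + `|t| + 1).
Proof.
move=> x h i; have := h i; rewrite mxE subr0 ltr_norml.
have := ler_norm t; have := ler_norm (- s); rewrite normrN.
by have := normr_ge0 s; have := normr_ge0 t; move=> *; apply/andP; split; lra.
Qed.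

Lemma lebesgue_box_fin s t : (mu (box s t) < +oo)%E.
Proof.
have r0 : 0 < `|s| + `|t| + 1 :> R by rewrite ltr_wpDl ?addr_ge0.
apply: le_lt_trans (lebesgue_cube_fin 0 r0).
apply: le_measure; rewrite ?inE; [exact: measurable_box|exact: measurable_cube|exact: box_cube].
Qed.

(** Inside a box of finite measure, the sets where [|Omega| <= 1 / (k + 1)] decrease to a null set.
    No [b] enters, so [delta] may appear in the final constant. *)
Lemma small_values_box (Omega : 'rV[R]_n -> R) s t e : measurable_fun setT Omega ->
  mu.-negligible [set x | Omega x = 0] -> 0 < e ->
  exists2 delta : R, 0 < delta &
    (mu (box s t `&` [set x | (`|Omega x| <= delta)%R]) <= e%:E)%E.
Proof.
move=> mO O0 e0.
have mS (a : R) : measurable (box s t `&` [set x | `|Omega x| <= a]).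
  apply: measurableI; first exact: measurable_box.
  rewrite (_ : [set _ | _] = setT `&` Omega @^-1` `[- a, a]).
    by apply: mO => //; exact: measurable_itv.
  by apply/seteqP; split => z; rewrite /= in_itv/= ler_norml//; case.
have [||||k Hk] := @nonincreasing_measure_le _ _ R mu
    (fun k => box s t `&` [set x | `|Omega x| <= k.+1%:R^-1]) e _ _ _ _ e0.
- apply: le_lt_trans (lebesgue_box_fin s t).
  by apply: le_measure; rewrite ?inE//; exact: measurable_box.
- by move=> k; exact: mS.
- move=> k l kl; apply/subsetPset => x [bx /= xl]; split => //=.
  by rewrite (le_trans xl)// lef_pV2 ?posrE// ler_nat.
- apply: measure_negligible; first by apply: bigcapT_measurable => k; exact: mS.
  apply: negligibleS O0 => x /= h; apply/eqP; rewrite -normr_le0.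
  rewrite leNgt; apply/negP => Ox; have [_ /=] := h (Num.truncn `|Omega x|^-1) I.
  by rewrite leNgt invf_plt ?posrE// truncnS_gt.
by exists k.+1%:R^-1.
Qed.

(** The sets where [|b| > k] decrease to the empty set. The level [M] depends on [b], but the bound
    in [far_set_bound] does not contain it. *)
Lemma large_values_box (b : 'rV[R]_n -> R) (P : set 'rV[R]_n) e : measurable_fun setT b ->
  measurable P -> (mu P < +oo)%E -> 0 < e ->
  exists M : R, (mu (P `&` [set x | (M < `|b x|)%R]) <= e%:E)%E.
Proof.
move=> mb mP Pfin e0.
have mS (a : R) : measurable (P `&` [set x | a < `|b x|]).
  apply: measurableI => //.
  rewrite (_ : [set _ | _] = setT `&` (fun x => `|b x|) @^-1` `]a, +oo[).
    by apply: (measurableT_comp _ mb) => //; exact: measurable_itv.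
  by apply/seteqP; split => z; rewrite /= in_itv/= andbT//; case.
have [||||k Hk] := @nonincreasing_measure_le _ _ R mu
    (fun k => P `&` [set x | k%:R < `|b x|]) e _ _ _ _ e0.
- apply: le_lt_trans Pfin; apply: le_measure; rewrite ?inE//.
- by move=> k; exact: mS.
- move=> k l kl; apply/subsetPset => x [bx /= xl]; split => //=.
  by rewrite (le_lt_trans _ xl)// ler_nat.
- rewrite (_ : \bigcap_k _ = set0) ?measure0// -subset0 => x /= h.
  have [_ /=] := h (Num.truncn `|b x|).+1 I.
  by rewrite ltNge ltW// truncnS_gt.
by exists k%:R.
Qed.

End small_values.

(** * The oscillation bound *)

Section oscillation_bound.
Context {R : realType} {n : nat}.
Local Notation mu := (lebesgue_rV n : {measure set 'rV[R]_n -> \bar R}).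
Variable Omega : 'rV[R]_n -> R.
Hypothesis n0 : (0 < n)%N.
Hypothesis Omega_lip : lipschitz_on_sphere Omega.
Hypothesis Omega_hom : homogeneous0 Omega.
Hypothesis Omega_neq0 : mu.-negligible [set x | Omega x = 0].

(** A cube [P] of side [r = |y1 - y2|] is covered by two sets to which [far_set_bound] applies and
    three exceptional ones of measure at most [r^n / 8] each: [Omega] small as seen from [y1] or
    from [y2], and [b] large. With [A] the factor in [far_set_bound], this gives
    [(5 / 8) A r^n <= 8 N], and in [A r^n] the distance [r] cancels. *)
Lemma oscillation_bound : exists2 C : R, 0 < C &
  forall b (N : R), loc_integrable b -> 0 <= N -> weak_type11_bound b Omega N ->
  forall y1 y2, essential_value b y1 -> essential_value b y2 ->
    `|b y1 - b y2| <= C * N.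
Proof.
have mO := measurable_homogeneous0 Omega_hom Omega_lip.
have [B B0 Omega_le] := homogeneous0_bounded Omega_hom Omega_lip n0.
have [L L0 Omega_dist] := homogeneous0_dist Omega_hom Omega_lip.
(* Rescaled by [r] and seen from either point, the cube [P] below lies in the box from 1 to 4. *)
have [delta d0 Zle] := small_values_box 1 4 mO Omega_neq0 (ltac:(lra) : 0 < 8^-1 :> R).
have nR : 0 < n%:R :> R by rewrite ltr0n.
exists (128 * (5 * n%:R) ^+ n / delta).
  by rewrite divr_gt0// mulr_gt0// exprn_gt0// mulr_gt0.
move=> b N b_int N0 weakN y1 y2 ess1 ess2.
have [mb _] := b_int.
have [->|y12] := eqVneq y1 y2.
  by rewrite subrr normr0 !mulr_ge0 ?invr_ge0 ?exprn_ge0 ?mulr_ge0// ltW.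
set D := `|b y1 - b y2|.
have [D0|D0] := leP D 0.
  by rewrite (le_trans D0)// !mulr_ge0 ?invr_ge0 ?exprn_ge0 ?mulr_ge0// ltW.
set r := `|y1 - y2|; have r0 : 0 < r by rewrite normr_gt0 subr_eq0.
have rV0 : 0 < r^-1 by rewrite invr_gt0.
pose phi (y x : 'rV[R]_n) : 'rV[R]_n := r^-1 *: x + - (r^-1 *: y).
have phiE y x : phi y x = r^-1 *: (x - y) by rewrite /phi scalerBr.
have mphi y : measurable_fun setT (phi y) by exact: measurable_rV_affine.
have muphi y A : measurable A -> mu (phi y @^-1` A) = ((r ^+ n)%:E * mu A)%E.
  move=> mA; have H : ((r^-1 ^+ n)%:E * mu (phi y @^-1` A) = mu A)%E.
    exact: lebesgue_rV_affine.
  rewrite -H muleA -EFinM.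
  by rewrite -exprMn divff ?gt_eqF// expr1n mul1e.
have mpre y A : measurable A -> measurable (phi y @^-1` A).
  by move=> mA; rewrite -[_ @^-1` _]setTI; exact: mphi.
pose Z := box 1 4 `&` [set x : 'rV[R]_n | `|Omega x| <= delta].
have mZ : measurable Z.
  apply: measurableI; first exact: measurable_box.
  rewrite (_ : [set _ | _] = setT `&` Omega @^-1` `[- delta, delta]).
    by apply: mO => //; exact: measurable_itv.
  by apply/seteqP; split => z; rewrite /= in_itv/= ler_norml//; case.
(* [P] is [y1] plus [r] times the box from 2 to 3. The coordinates of [y1 - y2] are at most [r] in
   size, so those of [x - y1] and [x - y2] lie between [r] and [4 * r]. *)
pose P := phi y1 @^-1` box 2 (2 + 1).
have mbox : measurable (box 2 (2 + 1) : set 'rV[R]_n) by exact: measurable_box.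
have mP : measurable P by exact: mpre.
have mubox : mu (box 2 (2 + 1)) = 1%E by exact: lebesgue_rV_unit_box.
have muP : mu P = (r ^+ n)%:E by rewrite muphi// mubox mule1.
have rn0 : 0 < r ^+ n by rewrite exprn_gt0.
have rn80 : 0 < r ^+ n / 8 by rewrite divr_gt0.
have [M Mle] := large_values_box mb mP (ltac:(by rewrite muP ltry)) rn80.
pose F (y : 'rV[R]_n) := P `&`
  [set x | [&& delta < `|Omega (x - y)|, `|b x| <= M & D / 2 <= `|b x - b y|]].
have mF y : measurable (F y).
  apply: measurableI => //.
  have mOy : measurable_fun setT (fun x : 'rV[R]_n => `|Omega (x - y)|).
    apply: (measurableT_comp (@normr_measurable R setT)); apply: (measurableT_comp mO).
    rewrite (_ : (fun _ => _) = (fun x : 'rV[R]_n => 1 *: x + - y)).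
      exact: measurable_rV_affine.
    by apply/funext => x; rewrite scale1r.
  have mbM : measurable_fun setT (fun x => `|b x|) by exact: measurableT_comp.
  have mby : measurable_fun setT (fun x => `|b x - b y|).
    by apply: measurableT_comp => //; apply: measurable_funB => //; exact: measurable_cst.
  rewrite (_ : [set _ | _] =
     (setT `&` (fun x : 'rV[R]_n => `|Omega (x - y)|) @^-1` `]delta, +oo[) `&`
     ((setT `&` (fun x => `|b x|) @^-1` `]-oo, M]) `&`
      (setT `&` (fun x => `|b x - b y|) @^-1` `[D / 2, +oo[))).
    by apply: measurableI; [|apply: measurableI];
      [apply: mOy|apply: mbM|apply: mby] => //; exact: measurable_itv.
  apply/seteqP; split => x /=; rewrite !in_itv/= !andbT.
    by move=> /and3P[].
  by move=> [[_ h1] [[_ h2] [_ h3]]]; apply/and3P.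
have far y : y = y1 \/ y = y2 -> forall x, P x -> forall i, r < x ord0 i - y ord0 i < 4 * r.
  move=> yy x Px i; have := Px i; rewrite phiE !mxE ltr_pdivlMl// ltr_pdivrMl// => /andP[x1 x2].
  have := coord_le_norm (y1 - y2) i; rewrite !mxE -/r ler_norml => /andP[h1 h2].
  by case: yy => ->; apply/andP; split; lra.
have far0 y : y = y1 \/ y = y2 -> forall x, P x -> r <= `|x - y| <= 4 * r.
  move=> yy x Px; apply/andP; split.
    have /andP[h1 h2] := far y yy x Px (Ordinal n0).
    have := coord_le_norm (x - y) (Ordinal n0); rewrite !mxE; apply: le_trans.
    by rewrite (le_trans (ltW h1))// ler_norm.
  apply: norm_rV_le => [|i]; first by rewrite mulr_ge0// ltW.
  have /andP[h1 h2] := far y yy x Px i; rewrite !mxE ger0_norm ?ltW//; lra.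
pose A := delta / 2 / (5 * n%:R * r) ^+ n * (D / 4).
have A0 : 0 < A by rewrite mulr_gt0 ?divr_gt0 ?exprn_gt0 ?mulr_gt0.
have AF y : essential_value b y -> y = y1 \/ y = y2 -> (A%:E * mu (F y) <= (4 * N)%:E)%E.
  move=> ess yy; apply: (far_set_bound n0 mO (ltW B0) Omega_le L0 Omega_dist b_int N0 weakN
    (M := M) ess) => //.
  by move=> x [Px /and3P[h1 h2 h3]]; split => //; exact: (far0 y yy x Px).
have AZ y : (A%:E * mu (phi y @^-1` Z) <= (A * (r ^+ n / 8))%:E)%E.
  by rewrite muphi// (EFinM A) lee_pmul2l ?lte_fin// (EFinM (r ^+ n)) lee_pmul2l ?lte_fin.
(* Outside the exceptional sets, [D <= |b x - b y1| + |b x - b y2|] forces one of the two terms to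
   be at least [D / 2]. *)
have cover : P `<=` F y1 `|` F y2 `|` (phi y1 @^-1` Z `|` phi y2 @^-1` Z `|`
    (P `&` [set x | M < `|b x|])).
  move=> x Px; have [bM|bM] := ltP M `|b x|; first by right; right.
  have inZ y : y = y1 \/ y = y2 -> `|Omega (x - y)| <= delta -> Z (phi y x).
    move=> yy Od; split => [i|].
      have /andP[h1 h2] := far y yy x Px i.
      by rewrite phiE !mxE ltr_pdivlMl// ltr_pdivrMl// mulr1 h1 mulrC.
    rewrite /= phiE Omega_hom//.
    by have /andP[h1 _] := far0 y yy x Px; rewrite -normr_gt0 (lt_le_trans r0).
  have [w1|w1] := leP `|Omega (x - y1)| delta.
    by right; left; left; apply: inZ => //; left.
  have [w2|w2] := leP `|Omega (x - y2)| delta.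
    by right; left; right; apply: inZ => //; right.
  have [h1|h1] := leP (D / 2) `|b x - b y1|.
    by left; left; split => //=; rewrite w1 bM.
  left; right; split => //=; rewrite w2 bM/=.
  have := ler_distD (b x) (b y1) (b y2); rewrite -/D (distrC (b y1)); lra.
have mbig : measurable (P `&` [set x | M < `|b x|]).
  apply: measurableI => //.
  rewrite (_ : [set _ | _] = setT `&` (fun x => `|b x|) @^-1` `]M, +oo[).
    by apply: (measurableT_comp _ mb) => //; exact: measurable_itv.
  by apply/seteqP; split => z; rewrite /= in_itv/= andbT//; case.
have Pbound : (mu P <= mu (F y1) + mu (F y2) + (mu (phi y1 @^-1` Z) + mu (phi y2 @^-1` Z) +
    mu (P `&` [set x | (M < `|b x|)%R])))%E.
  have mZ1 := mpre y1 Z mZ; have mZ2 := mpre y2 Z mZ.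
  have mFF := measurableU _ _ (mF y1) (mF y2); have mZZ := measurableU _ _ mZ1 mZ2.
  rewrite (le_trans (le_measure _ _ _ cover)) ?inE//.
    by apply: measurableU => //; exact: measurableU.
  rewrite (le_trans (measureU2 mu mFF (measurableU _ _ mZZ mbig)))//.
  apply: leeD; first exact: measureU2.
  rewrite (le_trans (measureU2 mu mZZ mbig))// leeD2r//; exact: measureU2.
have : (A%:E * mu P <= (4 * N + 4 * N +
    (A * (r ^+ n / 8) + A * (r ^+ n / 8) + A * (r ^+ n / 8)))%:E)%E.
  have A0' : (0 <= A%:E)%E by rewrite lee_fin ltW.
  apply: le_trans (lee_wpmul2l A0' Pbound) _.
  rewrite !ge0_muleDr ?adde_ge0// !EFinD; apply: leeD.
    by apply: leeD; apply: AF => //; [left|right].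
  apply: leeD; first by apply: leeD; exact: AZ.
  by rewrite (EFinM A) lee_pmul2l ?lte_fin.
rewrite muP -EFinM lee_fin.
have -> : A * (r ^+ n / 8) = A * r ^+ n / 8 by rewrite mulrA.
have c0 : 0 < (5 * n%:R) ^+ n :> R by rewrite exprn_gt0// mulr_gt0.
have -> : A * r ^+ n = D * (delta / (8 * (5 * n%:R) ^+ n)).
  rewrite /A (exprMn n (5 * n%:R)); field.
  by rewrite !gt_eqF.
set k := delta / _ => Dk.
have k0 : 0 < k by rewrite divr_gt0// mulr_gt0.
(* The estimate reads [(5 / 8) D k <= 8 N]; the factor 16 rounds up [64 / 5], and [16 / k] is the
   announced constant. *)
have {Dk} Dk : D * k <= 16 * N by lra.
rewrite (_ : 128 * (5 * n%:R) ^+ n / delta * N = 16 * N / k); last first.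
  by rewrite /k; field; rewrite !gt_eqF.
by rewrite ler_pdivlMr.
Qed.

End oscillation_bound.

(* The bound is modulo constants (commutator_norm_cst1). *)
Theorem theorem3p2 (R : realType) (n : nat) (Omega : 'rV[R]_n -> R)
    (n_gt0 : (0 < n)%N)
    (Omega_lip : lipschitz_on_sphere Omega)
    (Omega_hom : homogeneous0 Omega)
    (Omega_mean0 : (\int[sphere_measure]_(x in usphere) (Omega x)%:E = 0)%E)
    (Omega_neq0 : (lebesgue_rV n).-negligible [set x | Omega x = 0]) :
  exists2 C : R, 0 < C &
    forall b : 'rV[R]_n -> R, loc_integrable b ->
      (commutator_norm b Omega < +oo)%E ->
      b \in Lfun (lebesgue_rV n) +oo%E /\
      exists c : R,
        ('N[lebesgue_rV n]_+oo[EFin \o (fun x => b x - c)%R] <=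
         C%:E * commutator_norm b Omega)%E.
Proof.
have [C C0 oscC] := oscillation_bound n_gt0 Omega_lip Omega_hom Omega_neq0.
exists C => // b b_int norm_fin.
pose mu : {measure set 'rV[R]_n -> \bar R} := lebesgue_rV n.
have [mb _] := b_int.
(* Positive total measure provides an essential value, and makes the norm of index [+oo] an
   essential supremum. *)
have mu_gt0 : (0 < mu [set: 'rV[R]_n])%E.
  rewrite (@lt_le_trans _ _ (mu (box 0 (0 + 1))))//.
    by rewrite [X in (_ < X)%E](lebesgue_rV_unit_box n (0 : R)).
  by rewrite le_measure ?inE//; exact: measurable_box.
have ae_ess := ae_essential_value mb.
have [y0 ess0] : exists y, essential_value b y.
  apply/not_existsP => noess; have : mu.-negligible [set: 'rV[R]_n].
    by apply: negligibleS ae_ess => x _ /=; exact: noess.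
  by move=> /negligibleP -/(_ measurableT) E; rewrite E ltxx in mu_gt0.
have norm_ge0 : (0 <= commutator_norm b Omega)%E.
  by apply: le_ereal_inf_tmp => _ [N [N0 _] <-]; rewrite lee_fin.
(* The bound holds for every admissible [N]; after division by [C] it passes to the infimum. *)
have osc y : essential_value b y ->
    (`|b y - b y0|%:E <= C%:E * commutator_norm b Omega)%E.
  move=> ess; rewrite -lee_pdivrMl// -EFinM.
  apply: le_ereal_inf_tmp => _ [N [N0 weakN] <-].
  by rewrite lee_fin ler_pdivrMl// oscC.
have ae_osc : {ae mu, forall y, (`|b y - b y0|%:E <= C%:E * commutator_norm b Omega)%E}.
  by apply: filterS ae_ess.
split; last first.
  exists (b y0); rewrite unlock mu_gt0; apply/ess_supP.
  exact: ae_osc.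
rewrite inE; apply/andP; split; rewrite inE//= /finite_norm.
rewrite unlock mu_gt0.
(* Membership of [b] itself follows from [|b| <= |b y0| + |b - b y0|] and the finiteness of the
   commutator norm. *)
apply: (@le_lt_trans _ _ (`|b y0|%:E + C%:E * commutator_norm b Omega)%E); last first.
  by rewrite lte_add_pinfty ?ltry// lte_mul_pinfty// lee_fin ltW.
apply/ess_supP; apply: filterS ae_osc => y h /=.
rewrite -[b y](subrK (b y0)) addrC.
rewrite (@le_trans _ _ (`|b y0|%:E + `|b y - b y0|%:E)%E)//.
  by rewrite -EFinD lee_fin ler_normD.
by rewrite leeD2l.
Qed.
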